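(* Let $(\mathcal{G},\omega)$ be a Cartan geometry of type $(G,H)$ over a connected manifold $M$, let $o\in\mathcal{G}$, and let $J\leq G$ be a subgroup containing $\mathrm{Hol}_o(\mathcal{G},\omega)$. For $\varphi\in\mathrm{Aut}(\mathcal{G},\omega)$ and $u\in\mathcal{G}$, one has $\varphi(J\bullet u)=J\bullet u$ if and only if $\varphi(o)\in o\bullet J$, where the curved right coset $J\bullet u$ is taken with respect to the basepoint $o$.
   Context: A model geometry $(G,H)$ is a Lie group $G$ with a closed subgroup $H$ such that $G/H$ is connected. A Cartan geometry $(\mathcal{G},\omega)$ of type $(G,H)$ over $M$ is a (right) principal $H$-bundle $q_H:\mathcal{G}\to M$ with a $\mathfrak{g}$-valued 1-form $\omega$ such that each $\omega_u:T_u\mathcal{G}\to\mathfrak{g}$ is a linear isomorphism, $R_h^*\omega=\mathrm{Ad}_{h^{-1}}\omega$ for $h\in H$, and for $Y\in\mathfrak{h}$ the flow of $\omega^{-1}(Y)$ is $u\mapsto u\exp(tY)$. $\mathrm{Aut}(\mathcal{G},\omega)$ is the group of bijective $H$-equivariant maps $\varphi:\mathcal{G}\to\mathcal{G}$ with $\varphi^*\omega=\omega$. Paths are piecewise smooth. The development of a path $\gamma:[0,1]\to\mathcal{G}$ is the unique path $\gamma_G$ in $G$ with $\gamma_G(0)=e$ and $\gamma^*\omega=\gamma_G^*\omega_G$, $\omega_G$ the Maurer–Cartan form. An element $g\in G$ is a development of $u'\in\mathcal{G}$ from $u\in\mathcal{G}$ if there are a path $\gamma:[0,1]\to\mathcal{G}$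 and $h\in H$ with $\gamma(0)=u$, $\gamma(1)h=u'$, $\gamma_G(1)h=g$. The holonomy group is $\mathrm{Hol}_u(\mathcal{G},\omega)=\{\gamma_G(1)h: h\in H,\ \gamma(0)=u=\gamma(1)h\}$. For a subgroup $J\leq G$ containing $\mathrm{Hol}_u(\mathcal{G},\omega)$, the curved (left) coset is $u\bullet J=\{\gamma(1)h: h\in H,\ \gamma(0)=u,\ \gamma_G(1)h\in J\}$, the set of points with a development from $u$ in $J$. For a fixed basepoint $o$ with $\mathrm{Hol}_o(\mathcal{G},\omega)\leq J$, the curved (right) coset through $u$ is $J\bullet u:=u\bullet(g^{-1}Jg)$, where $g$ is any development of $u$ from $o$ (independent of the choice of $g$). *)

(* Defs.v *)
From HB Require Import structures.
From mathcomp Require Import all_boot all_order all_algebra.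
From mathcomp Require Import all_classical all_reals all_analysis.
Import Order.TTheory GRing.Theory Num.Theory.
Import numFieldNormedType.Exports.

Set Implicit Arguments.
Unset Strict Implicit.
Unset Printing Implicit Defensive.

Local Open Scope classical_set_scope.
Local Open Scope ring_scope.

(* Only meant for U open. In finite dimension, f is C^(k+1) on U iff it is
   differentiable on U and all its directional derivatives are C^k on U. *)
Fixpoint Ck {R : realType} {V W : normedModType R} (k : nat) (U : set V)
    (f : V -> W) : Prop :=
  match k with
  | 0 => forall x, U x -> {for x, continuous f}
  | k.+1 => (forall x, U x -> differentiable f x) /\
            (forall v : V, Ck k U (fun x => 'D_v f x))
  end.

Definition Cinfty {R : realType} {V W : normedModType R} (U : set V)
  (f : V -> W) : Prop := forall k, Ck k U f.

Record chart (R : realType) (n : nat) (T : Type) := Chart {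
  chart_dom : set T;
  chart_map :> T -> 'rV[R]_n;
  chart_inv : 'rV[R]_n -> T }.

(* An atlas indexed by the points of T, chart_at x being a chart around x. Any
   atlas can be put in this form, by choosing one of its charts around each
   point; the smooth structure it generates is unchanged. *)
HB.mixin Record hasCharts (R : realType) (n : nat) T of Topological T := {
  chart_at : T -> chart R n T }.

#[short(type="chartedType")]
HB.structure Definition Charted (R : realType) (n : nat) :=
  {T of Topological T & hasCharts R n T}.

Definition prod_chart (R : realType) (m n : nat) (T T' : Type)
    (c : chart R m T) (c' : chart R n T') : chart R (m + n) (T * T')%type :=
  Chart (chart_dom c `*` chart_dom c')
    (fun z => row_mx (c z.1) (c' z.2))
    (fun v => (chart_inv c (lsubmx v), chart_inv c' (rsubmx v))).

HB.instance Definition _ (R : realType) (m n : nat)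
    (T : chartedType R m) (T' : chartedType R n) :=
  hasCharts.Build R (m + n)%N (T * T')%type
    (fun z => prod_chart (chart_at z.1) (chart_at z.2)).

HB.mixin Record Charted_isManifold (R : realType) (n : nat) T
    of Charted R n T := {
  manifold_hausdorff : hausdorff_space T;
  manifold_second_countable : @second_countable T;
  chart_at_dom : forall x : T, chart_dom (chart_at x) x;
  chart_dom_open : forall x : T, open (chart_dom (chart_at x));
  chart_img_open : forall x : T,
    open (chart_at x @` chart_dom (chart_at x));
  chart_mapK : forall x : T,
    {in chart_dom (chart_at x), cancel (chart_at x) (chart_inv (chart_at x))};
  chart_map_continuous : forall x y : T,
    chart_dom (chart_at x) y -> {for y, continuous (chart_at x)};
  chart_inv_continuous : forall x y : T, chart_dom (chart_at x) y ->
    {for chart_at x y, continuous (chart_inv (chart_at x))};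
  chart_transition : forall x y : T,
    Cinfty (chart_at x @` (chart_dom (chart_at x) `&` chart_dom (chart_at y)))
           (chart_at y \o chart_inv (chart_at x)) }.

#[short(type="manifoldType")]
HB.structure Definition Manifold (R : realType) (n : nat) :=
  {T of Charted R n T & Charted_isManifold R n T}.

(* The tangent space at x, its vectors being given by their coordinates in the
   chart chart_at x. *)
Definition tangent (R : realType) (n : nat) (T : chartedType R n)
    (x : T) : lmodType R := 'rV[R]_n.

Section Smooth.
Context {R : realType} {m n : nat}.

Definition smooth_open {S : chartedType R m} {T : chartedType R n}
    (U : set S) (f : S -> T) : Prop :=
  (forall x, U x -> {for x, continuous f}) /\
  forall (x : S) (y : T),
    Cinfty (chart_at x @`
              (chart_dom (chart_at x) `&` U `&` f @^-1` chart_dom (chart_at y)))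
           (chart_at y \o f \o chart_inv (chart_at x)).

(* Smoothness on an arbitrary subset: local extendability to a smooth map. On
   an embedded submanifold A, this is smoothness for its manifold structure. *)
Definition smooth_on {S : chartedType R m} {T : chartedType R n}
    (A : set S) (f : S -> T) : Prop :=
  forall x, A x -> exists (U : set S) (F : S -> T),
    [/\ open U, U x, smooth_open U F & {in A `&` U, F =1 f}].

Definition smooth {S : chartedType R m} {T : chartedType R n} (f : S -> T) :=
  smooth_open [set: S] f.

Definition tmap {S : chartedType R m} {T : chartedType R n} (f : S -> T)
    (x : S) (v : tangent x) : tangent (f x) :=
  'd (chart_at (f x) \o f \o chart_inv (chart_at x)) (chart_at x x) v.

(* The coordinate vector field with constant coordinates v in the chart
   chart_at x, evaluated at the point of coordinates z. *)
Definition coord_field (T : chartedType R n) (x : T) (v z : 'rV[R]_n) :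
    tangent (chart_inv (chart_at x) z) :=
  'd (chart_at (chart_inv (chart_at x) z) \o chart_inv (chart_at x)) z v.

Definition smooth_curve {T : chartedType R n} (U : set R) (c : R -> T) : Prop :=
  (forall t, U t -> {for t, continuous c}) /\
  forall y : T, Cinfty (U `&` c @^-1` chart_dom (chart_at y)) (chart_at y \o c).

Definition velocity {T : chartedType R n} (c : R -> T) (t : R) :
    tangent (c t) :=
  derive1 (chart_at (c t) \o c) t.

(* The values of c outside [0, 1] are irrelevant. *)
Definition piecewise_smooth {T : chartedType R n} (c : R -> T) : Prop :=
  exists2 s : seq R, itv_partition 0 1 s &
  forall i, (i < size s)%N ->
    let I := `[nth 0 (0 :: s) i, nth 0 (0 :: s) i.+1]%classic in
    exists (U : set R) (c' : R -> T),
      [/\ open U, I `<=` U, smooth_curve U c' & {in I, c' =1 c}].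

End Smooth.

HB.mixin Record Manifold_isLie (R : realType) (n : nat) G
    of Manifold R n G & Group G := {
  lie_mul_smooth : smooth (fun x : (G * G)%type => (x.1 * x.2)%g);
  lie_inv_smooth : smooth (fun x : G => x^-1%g) }.

#[short(type="lieGroupType")]
HB.structure Definition LieGroup (R : realType) (n : nat) :=
  {G of Manifold R n G & Group G & Manifold_isLie R n G}.

Notation lie_algebra G := (tangent (1%g : G)).

Section LieGroups.
Context {R : realType} {n : nat} (G : lieGroupType R n).

Definition Ad (g : G) (Y : lie_algebra G) : lie_algebra G :=
  tmap (fun x : G => (g * x * g^-1)%g) Y.

Definition maurer_cartan (g : G) (v : tangent g) : lie_algebra G :=
  tmap (fun x : G => (g^-1 * x)%g) v.

(* c is the map t |-> exp (t Y). *)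
Definition one_parameter_subgroup (Y : lie_algebra G) (c : R -> G) : Prop :=
  [/\ smooth_curve [set: R] c,
      forall s t, c (s + t) = (c s * c t)%g
    & velocity c 0 = Y].

Definition subgroup (J : set G) : Prop :=
  [/\ J 1%g, forall x y, J x -> J y -> J (x * y)%g & forall x, J x -> J x^-1%g].

Record closedSubgroup := ClosedSubgroup {
  closed_subgroup_set :> set G;
  closed_subgroupP : subgroup closed_subgroup_set;
  closed_subgroup_closed : closed closed_subgroup_set }.

Definition in_closed_subgroup (H : closedSubgroup) : G -> Prop :=
  closed_subgroup_set H.
Coercion in_closed_subgroup : closedSubgroup >-> Funclass.

Section Quotient.
Variable H : closedSubgroup.

Definition coset_rel : rel G := fun x y => `[< H (x^-1 * y)%g >].

Fact coset_equiv : equiv_class_of coset_rel.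
Proof.
have [H1 HM HV] := closed_subgroupP H; split.
- by move=> x; apply/asboolP; rewrite mulVg.
- by move=> x y; apply/asboolP/asboolP => /HV; rewrite invgM invgK.
- move=> y x z /asboolP Hxy /asboolP Hyz; apply/asboolP.
  by have := HM _ _ Hxy Hyz; rewrite mulgA mulgK.
Qed.

Canonical coset_equiv_rel := EquivRelPack coset_equiv.

Definition coset_space : topologicalType :=
  quotient_topology {eq_quot coset_equiv_rel}%qT.

End Quotient.

Record modelGeometry := ModelGeometry {
  model_stab :> closedSubgroup;
  model_connected : connected [set: coset_space model_stab] }.

End LieGroups.

Section Cartan.
Context {R : realType} {n p d : nat} {G : lieGroupType R n}.

(* Right principal H-bundle; a closed subgroup H is an embedded submanifold of
   G, so smoothness of maps to or from H can be tested in G. Only the values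
   act u h with h in H matter. *)
Record principalBundle (H : closedSubgroup G) (P : manifoldType R p)
    (M : manifoldType R d) := PrincipalBundle {
  proj : P -> M;
  act : P -> G -> P;
  proj_smooth : smooth proj;
  act_smooth : smooth_on ([set: P] `*` H) (fun z : (P * G)%type => act z.1 z.2);
  act1 : forall u, act u 1%g = u;
  actM : forall u h k, H h -> H k -> act u (h * k)%g = act (act u h) k;
  proj_act : forall u h, H h -> proj (act u h) = proj u;
  local_triviality : forall x : M, exists (U : set M)
      (Phi : P -> (M * G)%type) (Psi : (M * G)%type -> P),
    [/\ open U, U x,
        set_bij (proj @^-1` U) (U `*` H) Phi,
        {in proj @^-1` U, cancel Phi Psi}
      & [/\ smooth_on (proj @^-1` U) Phi,
            smooth_on (U `*` H) Psi,
            forall u, U (proj u) -> (Phi u).1 = proj u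
          & forall u h, U (proj u) -> H h ->
              Phi (act u h) = ((Phi u).1, ((Phi u).2 * h)%g)]] }.

Record cartanGeometry (H : modelGeometry G) (P : manifoldType R p)
    (M : manifoldType R d) := CartanGeometry {
  bundle :> principalBundle H P M;
  omega : forall u : P, {linear tangent u -> lie_algebra G};
  omega_smooth : forall (x : P) (v : 'rV[R]_p),
    Cinfty (chart_at x @` chart_dom (chart_at x))
      (fun z => omega (chart_inv (chart_at x) z) (coord_field x v z)
                : 'rV[R]_n);
  omega_bij : forall u, bijective (omega u);
  omega_equivariant : forall h, H h -> forall (u : P) (v : tangent u),
    omega (act bundle u h) (tmap (fun w => act bundle w h) v) =
    Ad h^-1%g (omega u v);
  (* Y in the Lie algebra of H: exp (t Y) stays in H. *)
  omega_fundamental : forall (Y : lie_algebra G) (c : R -> G),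
    one_parameter_subgroup Y c -> (forall t, H (c t)) ->
    forall (u : P) (t : R),
      omega (act bundle u (c t)) (velocity (fun s => act bundle u (c s)) t) =
      Y }.

Section Development.
Context {H : modelGeometry G} {P : manifoldType R p} {M : manifoldType R d}.
Variable C : cartanGeometry H P M.

Definition automorphism (phi : P -> P) : Prop :=
  [/\ bijective phi, smooth phi,
      forall u h, H h -> phi (act C u h) = act C (phi u) h
    & forall (u : P) (v : tangent u), omega C (phi u) (tmap phi v) = omega C u v].

(* The equality of pullbacks is required away from finitely many times, since
   velocities need not exist at the break points; by continuity, it then also
   holds for the one-sided velocities at these times. *)
Definition development (gamma : R -> P) (gammaG : R -> G) : Prop :=
  [/\ piecewise_smooth gammaG, gammaG 0 = 1%g
    & exists s : seq R, forall t, 0 < t < 1 -> t \notin s ->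
        omega C (gamma t) (velocity gamma t) =
        maurer_cartan (velocity gammaG t)].

Definition is_development_of (u u' : P) (g : G) : Prop :=
  exists (gamma : R -> P) (gammaG : R -> G) (h : G),
    [/\ piecewise_smooth gamma, development gamma gammaG & H h] /\
    [/\ gamma 0 = u, act C (gamma 1) h = u' & (gammaG 1%R * h)%g = g].

Definition holonomy (u : P) : set G := [set g | is_development_of u u g].

Definition curved_left_coset (u : P) (J : set G) : set P :=
  [set u' | exists2 g, J g & is_development_of u u' g].

Definition conj_set (J : set G) (g : G) : set G := [set (x ^ g)%g | x in J].

(* When J is a subgroup containing holonomy o, the set
   curved_left_coset u (conj_set J g) does not depend on the development g of u
   from o. *)
Definition curved_right_coset (o : P) (J : set G) (u : P) : set P :=
  [set u' | exists2 g, is_development_of o u g &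
                       curved_left_coset u (conj_set J g) u'].

End Development.
End Cartan.

(* Main.v *)
Require Import Defs.
From HB Require Import structures.
From mathcomp Require Import all_boot all_order all_algebra.
From mathcomp Require Import all_classical all_reals all_analysis.
From mathcomp Require Import ring lra.
Import Order.TTheory GRing.Theory Num.Theory.
Import numFieldNormedType.Exports.

Set Implicit Arguments.
Unset Strict Implicit.
Unset Printing Implicit Defensive.

Local Open Scope classical_set_scope.
Local Open Scope ring_scope.

(** Write D(u, u') for the set of developments of u' from u. Concatenating and
    reversing paths, and moving the elements of H to the end by equivariance,
    makes D a groupoid: D(u, u') D(u', u'') is contained in D(u, u''), and
    D(u, u')^-1 in D(u', u). An automorphism phi preserves omega, so it maps a
    path to one with the same development: D(u, u') is contained in
    D(phi u, phi u').

    Hence u' belongs to the right coset of u iff some product x g, with x in J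
    and g in D(o, u), is a development of u' from o. If phi preserves this
    coset, then phi u has such a development x g; since g also lies in
    D(phi o, phi u), the quotient x = (x g) g^-1 lies in D(o, phi o), and phi o
    is in the left coset of o. Conversely, let x be an element of J in
    D(o, phi o). Left multiplication by x turns a development of w from o into
    one of phi w, so phi maps the coset into itself. To reach a point w of the
    coset, take a development k from o of its preimage under phi: then x k and
    any y g witnessing that w is in the coset are both developments of w, they
    differ by an element of the holonomy group of o, and so k lies in J g.

    All of this needs D(o, u) to be nonempty for every u, and there the
    connectedness of M and some analysis come in. A point u' close to u is
    joined to u by a segment in a chart; in the chart of G at 1 the development
    of that segment solves an ordinary differential equation whose right-hand
    side is linear in the direction v of the segment, so that for v small the
    solution given by Picard iteration lives up to time 1
    ([picard], [ode_local], [local_development]). The solution is smooth because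
    the equation is. Therefore the set of points with a development from o is
    open and closed, and stable under H; its projection to M is open and closed,
    hence is M ([development_exists]). *)

(** * Calculus of maps of class C^k *)

Section CkTheory.
Context {R : realType}.
Implicit Types V W : normedModType R.

(** The differential of f serves as that of g: the two functions have the same
    increments near x. *)
Lemma near_eq_differentiable V W (f g : V -> W) (x : V) :
  (\near x, f x = g x) -> differentiable f x -> differentiable g x.
Proof.
move=> fg df; have [dfc dfE] := (diff_locallyP _ _).1 df.
have gE : g \o shift x = cst (g x) + 'd f x +o_ 0 id.
  apply/eqaddoP => e e0.
  have /eqaddoP/(_ e e0) H := dfE.
  have fgx : f x = g x by exact: (nbhs_singleton fg).
  have fg0 : \forall h \near (0 : V), f (h + x) = g (h + x).
    have : (h + x) @[h --> (0 : V)] --> x.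
      by rewrite -[X in _ --> X]add0r; apply: cvgD; [exact: cvg_id|exact: cvg_cst].
    by move=> /(_ _ fg).
  near=> h.
  have : f (h + x) = g (h + x) by near: h.
  have : `|(f \o shift x - (cst (f x) + 'd f x)) h| <= e * `|id h| by near: h.
  by move=> + fgh; rewrite /= !fctE /= fgh fgx.
have dg : 'd g x = 'd f x :> (V -> W) by apply: diff_unique.
by apply/diff_locallyP; rewrite dg.
Unshelve. all: by end_near. Qed.

Lemma Ck_sub V W k (U U' : set V) (f : V -> W) :
  U' `<=` U -> Ck k U f -> Ck k U' f.
Proof.
elim: k f => [|k IH] f UU' /=; first by move=> fU x /UU'/fU.
by move=> [df Df]; split=> [x /UU'/df//|v]; exact: IH.
Qed.

(** The definition only speaks of derivatives at the points of U, taken in the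
    whole space, so class C^k can be tested one point at a time. This is what
    makes the notion local. *)
Lemma Ck_ptwise V W k (U : set V) (f : V -> W) :
  (forall x, U x -> Ck k [set x] f) -> Ck k U f.
Proof.
elim: k f => [|k IH] f /= fU; first by move=> x Ux; exact: (fU x Ux x erefl).
split=> [x Ux|v]; first exact: ((fU x Ux).1 x erefl).
by apply: IH => x Ux; exact: (fU x Ux).2.
Qed.

Lemma Ck_near_eq V W k (x : V) (f g : V -> W) :
  (\near x, f x = g x) -> Ck k [set x] f -> Ck k [set x] g.
Proof.
elim: k f g => [|k IH] f g fg /=.
  move=> fx _ ->; have fgx := nbhs_singleton fg.
  rewrite /prop_for /continuous_at -fgx.
  by apply: cvg_trans (fx x erefl); apply: near_eq_cvg.
move=> [df Df]; split=> [_ ->|v]; first exact: near_eq_differentiable fg (df _ _).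
apply: IH (Df v); apply: filterS (nbhs_interior fg) => y fgy.
exact: near_eq_derive.
Qed.

Lemma Ck_near V W k (U : set V) (f g : V -> W) :
  (forall x, U x -> \near x, f x = g x) -> Ck k U f -> Ck k U g.
Proof.
move=> fg fU; apply: Ck_ptwise => x Ux.
by apply: Ck_near_eq (fg x Ux) (Ck_sub _ fU) => _ ->.
Qed.

Lemma Ck_ext V W k (U : set V) (f g : V -> W) :
  open U -> {in U, f =1 g} -> Ck k U f -> Ck k U g.
Proof.
move=> Uo fg; apply: Ck_near => x Ux.
by apply: filterS (open_nbhs_nbhs (conj Uo Ux)) => y Uy; apply/fg/mem_set.
Qed.

Lemma CkW V W k (U : set V) (f : V -> W) : Ck k.+1 U f -> Ck k U f.
Proof.
elim: k f => [|k IH] f [df Df].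
  by move=> x /df; exact: differentiable_continuous.
by split=> // v; exact: IH.
Qed.

Lemma Ck_cst V W k (U : set V) (c : W) : Ck k U (cst c : V -> W).
Proof.
elim: k c => [|k IH] c /=; first by move=> x _; exact: cst_continuous.
split=> // v; have -> : 'D_v (cst c) = cst 0 :> (V -> W).
  by apply/funext => x; rewrite derive_cst.
exact: IH.
Qed.

(** Covers linear maps and their translates. *)
Lemma Ck_cst_derive V W k (U : set V) (f : V -> W) (df : V -> W) :
  (forall x, differentiable f x) -> (forall v, 'D_v f = cst (df v)) -> Ck k U f.
Proof.
case: k => [|k] fd Df; first by move=> x _; exact: differentiable_continuous.
by split=> // v; rewrite Df; exact: Ck_cst.
Qed.

Lemma Ck_add V W k (U : set V) (f g : V -> W) : open U ->
  Ck k U f -> Ck k U g -> Ck k U (fun x => f x + g x).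
Proof.
move=> Uo; elim: k f g => [|k IH] f g /=.
  by move=> fU gU x Ux; apply: cvgD; [exact: fU|exact: gU].
move=> [df Df] [dg Dg]; split=> [x Ux|v].
  by apply: differentiableD; [exact: df|exact: dg].
apply: (Ck_ext Uo) (IH _ _ (Df v) (Dg v)) => x /set_mem Ux.
by rewrite (@deriveD _ _ _ f g)//; apply: diff_derivable; [exact: df|exact: dg].
Qed.

Lemma Ck_sum V W k (U : set V) (I : Type) (r : seq I) (f : I -> V -> W) :
  open U -> (forall i, Ck k U (f i)) -> Ck k U (fun x => \sum_(i <- r) f i x).
Proof.
move=> Uo fU; elim: r => [|i r IH].
  by under eq_fun do rewrite big_nil; exact: Ck_cst.
by under eq_fun do rewrite big_cons; exact: Ck_add.
Qed.

Lemma Ck_mul V k (U : set V) (f g : V -> R) : open U ->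
  Ck k U f -> Ck k U g -> Ck k U (fun x => f x * g x).
Proof.
move=> Uo; elim: k f g => [|k IH] f g.
  by move=> fU gU x Ux; apply: cvgM; [exact: fU|exact: gU].
move=> fU gU; have [df Df] := fU; have [dg Dg] := gU; split=> [x Ux|v].
  by apply: differentiableM; [exact: df|exact: dg].
have H := Ck_add Uo (IH _ _ (CkW fU) (Dg v)) (IH _ _ (CkW gU) (Df v)).
apply: (Ck_ext Uo) H => x /set_mem Ux.
by rewrite (@deriveM _ _ f g)//; apply: diff_derivable; [exact: df|exact: dg].
Qed.

Lemma differentiable_rVP V n (f : V -> 'rV[R]_n) x :
  differentiable f x <-> forall i, differentiable (fun z => f z 0 i) x.
Proof.
split=> [df i|df].
  exact: (differentiable_comp df (differentiable_coord _ _ _)).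
have -> : f = \sum_(i < n) (fun z => f z 0 i *: (delta_mx 0 i : 'rV[R]_n)).
  by apply/funext => z; rewrite fct_sumE; exact: row_sum_delta.
by apply: differentiable_sum => i; exact: differentiableZl.
Qed.

Lemma derive_rV V n (f : V -> 'rV[R]_n) x v i : differentiable f x ->
  'D_v f x 0 i = 'D_v (fun z => f z 0 i) x.
Proof. by move=> df; rewrite derive_mx ?mxE//; exact: diff_derivable. Qed.

Lemma cvg_rV (T : topologicalType) n (f : T -> 'rV[R]_n) (x : T) :
  (forall i, {for x, continuous (fun z => f z 0 i)}) -> {for x, continuous f}.
Proof.
move=> fc; apply/cvgrPdist_le => /= e e0; near=> t.
rewrite /Num.Def.normr/= mx_normrE (bigmax_le _ (ltW e0))//= => -[i j] _.
rewrite !mxE/= ord1; move: j; near: t; apply: filter_forall => j.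
by have /cvgrPdist_le/(_ e e0) := fc j.
Unshelve. all: by end_near. Qed.

(** U is open because the partial derivatives of f and of its coordinates
    are only known to correspond at points where f is differentiable. *)
Lemma Ck_rVP V n k (U : set V) (f : V -> 'rV[R]_n) : open U ->
  Ck k U f <-> forall i, Ck k U (fun z => f z 0 i).
Proof.
move=> Uo; elim: k f => [|k IH] f /=.
  split=> [fU i x Ux|fU x Ux].
    apply: (@continuous_comp _ _ _ f (fun z : 'rV[R]_n => z 0 i)); [exact: fU|exact: coord_continuous].
  by apply: cvg_rV => i; exact: fU.
split=> [[df Df] i|fU].
  split=> [x /df/differentiable_rVP//|v].
  apply: (Ck_ext Uo) ((IH _).1 (Df v) i) => x /set_mem Ux.
  by rewrite derive_rV//; exact: df.
have df x : U x -> differentiable f x.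
  by move=> Ux; apply/differentiable_rVP => i; exact: (fU i).1.
split=> // v; apply/IH => i.
apply: (Ck_ext Uo) ((fU i).2 v) => x /set_mem Ux.
by rewrite derive_rV//; exact: df.
Qed.

Lemma Ck_scale V n k (U : set V) (f : V -> R) (g : V -> 'rV[R]_n) : open U ->
  Ck k U f -> Ck k U g -> Ck k U (fun x => f x *: g x).
Proof.
move=> Uo fU /(Ck_rVP _ _ Uo) gU; apply/Ck_rVP => // i.
under eq_fun do rewrite mxE; exact: Ck_mul.
Qed.

Lemma diff_rV_sum m W (f : 'rV[R]_m -> W) x v : differentiable f x ->
  'd f x v = \sum_(j < m) v 0 j *: 'D_(delta_mx 0 j) f x.
Proof.
move=> df; rewrite {1}(row_sum_delta v) linear_sum; apply: eq_bigr => j _.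
by rewrite linearZ deriveE.
Qed.

(** Induction on k: the derivative of the composite in the direction v is the sum
    of the partial derivatives of f composed with g, weighted by the coordinates
    of the derivative of g, and C^k maps are closed under such sums and
    products. *)
Lemma Ck_comp V m n k (U : set V) (A : set 'rV[R]_m) (g : V -> 'rV[R]_m)
    (f : 'rV[R]_m -> 'rV[R]_n) :
  open U -> (forall x, U x -> A (g x)) -> Ck k U g -> Ck k A f ->
  Ck k U (f \o g).
Proof.
move=> Uo UA; elim: k f => [|k IH] f gU fA.
  by move=> x Ux; apply: continuous_comp; [exact: gU|exact/fA/UA].
have [dg Dg] := gU; have [df Df] := fA; split=> [x Ux|v].
  by apply: differentiable_comp; [exact: dg|exact/df/UA].
have H : Ck k U (fun x => \sum_(j < m)
    'D_v g x 0 j *: ('D_(delta_mx 0 j) f \o g) x).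
  apply: Ck_sum => // j; apply: Ck_scale => //.
    exact: ((Ck_rVP _ _ Uo).1 (Dg v) j).
  exact: IH (CkW gU) (Df _).
apply: (Ck_ext Uo) H => x /set_mem Ux /=.
have dgx := dg x Ux; have dfx := df _ (UA _ Ux).
rewrite [RHS]deriveE; last exact: differentiable_comp.
by rewrite diff_comp//= diff_rV_sum// deriveE.
Qed.

Lemma Cinfty_comp V m n (U : set V) (A : set 'rV[R]_m) (g : V -> 'rV[R]_m)
    (f : 'rV[R]_m -> 'rV[R]_n) :
  open U -> (forall x, U x -> A (g x)) -> Cinfty U g -> Cinfty A f ->
  Cinfty U (f \o g).
Proof. by move=> Uo UA gU fA k; apply: Ck_comp (gU k) (fA k). Qed.

Lemma Cinfty_continuous V W (U : set V) (f : V -> W) x : Cinfty U f -> U x ->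
  {for x, continuous f}.
Proof. by move=> fU; exact: (fU 0). Qed.

Lemma Cinfty_differentiable V W (U : set V) (f : V -> W) x : Cinfty U f -> U x ->
  differentiable f x.
Proof. by move=> fU; exact: (fU 1).1. Qed.

Lemma derive_affine V V' W (aff L : V' -> V) (f : V -> W) x v :
  is_diff x aff L -> differentiable f (aff x) ->
  is_derive x v (f \o aff) ('D_(L v) f (aff x)).
Proof.
move=> da df; have dfa : differentiable (f \o aff) x.
  by apply: differentiable_comp => //; exact: ex_diff.
apply: DeriveDef; first exact: diff_derivable.
by rewrite !deriveE// diff_comp//= diff_val.
Qed.

Lemma Ck_affine V V' W k (U : set V) (aff L : V' -> V) (f : V -> W) :
  (forall x, is_diff x aff L) -> open U ->
  Ck k U f -> Ck k (aff @^-1` U) (f \o aff).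
Proof.
move=> da Uo; have ac : continuous aff.
  by move=> t; exact/differentiable_continuous.
have Vo : open (aff @^-1` U) by exact: open_comp.
elim: k f => [|k IH] f.
  by move=> fU t Ut; apply: continuous_comp; [exact: ac|exact: fU].
move=> [df Df]; split=> [t Ut|v].
  by apply: differentiable_comp; [exact: ex_diff|exact: df].
apply: (Ck_ext Vo) (IH _ (Df (L v))) => t /set_mem Ut /=.
by have [_ ->] := derive_affine v (da t) (df _ Ut).
Qed.

Lemma is_diff_affine (a b t : R) : is_diff t (fun s => a * s + b) ( *%R a).
Proof.
have -> : (fun s : R => a * s + b) = ( *:%R a) + cst b by [].
by apply: is_diff_eq; rewrite addr0.
Qed.

End CkTheory.

Section AffineMaps.
Context {R : realType}.

(** A map with the same differential everywhere has constant directional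
    derivatives. *)
Lemma Cinfty_affine (V W : normedModType R) (U : set V) (f L : V -> W) :
  (forall x, is_diff x f L) -> Cinfty U f.
Proof.
move=> df k; apply: (@Ck_cst_derive _ _ _ _ _ _ L) => [x|v].
  by have [] := df x.
by apply/funext => x; have [dfx dE] := df x; rewrite deriveE// dE.
Qed.

Lemma is_diff_linear_cst (V W : normedModType R) (L : {linear V -> W}) (c : W)
  (x : V) : continuous L -> is_diff x (fun y => L y + c) L.
Proof.
move=> Lc; have ? : is_diff x L L.
  by apply: DiffDef; [exact: linear_differentiable|rewrite diff_lin].
have -> : (fun y => L y + c) = (L : V -> W) + cst c by [].
by apply: is_diff_eq; rewrite addr0.
Qed.

Lemma is_diff_row_mxl n p (z : 'rV[R]_p) (y : 'rV[R]_n) :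
  is_diff y (fun y => row_mx y z) (fun y => row_mx y 0).
Proof.
have lin : linear (fun y : 'rV[R]_n => row_mx y (0 : 'rV[R]_p)).
  by move=> a u v; rewrite scale_row_mx scaler0 add_row_mx addr0.
pose linM := GRing.isLinear.Build _ _ _ _ _ lin.
pose L : {linear 'rV[R]_n -> 'rV[R]_(n + p)} :=
  HB.pack (fun y : 'rV[R]_n => row_mx y (0 : 'rV[R]_p)) linM.
have -> : (fun y : 'rV[R]_n => row_mx y z) = (fun y => L y + row_mx 0 z).
  by apply/funext => x; rewrite /= add_row_mx addr0 add0r.
apply: (is_diff_linear_cst (L := L)) => x; apply: cvg_rV => i.
rewrite -(splitK i); case: (fintype.split i) => j;
  rewrite /prop_for /continuous_at /=.
  rewrite row_mxEl; under eq_fun do rewrite row_mxEl; exact: coord_continuous.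
rewrite row_mxEr; under eq_fun do rewrite row_mxEr; exact: cst_continuous.
Qed.

Lemma is_diff_row_mxr n p (z : 'rV[R]_p) (y : 'rV[R]_n) :
  is_diff y (fun y => row_mx z y) (fun y => row_mx 0 y).
Proof.
have lin : linear (fun y : 'rV[R]_n => row_mx (0 : 'rV[R]_p) y).
  by move=> a u v; rewrite scale_row_mx scaler0 add_row_mx addr0.
pose linM := GRing.isLinear.Build _ _ _ _ _ lin.
pose L : {linear 'rV[R]_n -> 'rV[R]_(p + n)} :=
  HB.pack (fun y : 'rV[R]_n => row_mx (0 : 'rV[R]_p) y) linM.
have -> : (fun y : 'rV[R]_n => row_mx z y) = (fun y => L y + row_mx z 0).
  by apply/funext => x; rewrite /= add_row_mx addr0 add0r.
apply: (is_diff_linear_cst (L := L)) => x; apply: cvg_rV => i.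
rewrite -(splitK i); case: (fintype.split i) => j;
  rewrite /prop_for /continuous_at /=.
  rewrite row_mxEl; under eq_fun do rewrite row_mxEl; exact: cst_continuous.
rewrite row_mxEr; under eq_fun do rewrite row_mxEr; exact: coord_continuous.
Qed.

Lemma is_diff_line n (v z : 'rV[R]_n) (t : R) :
  is_diff t (fun t : R => t *: v + z) (fun t : R => t *: v).
Proof.
have -> : (fun t : R => t *: v + z) = ( *:%R ^~ v) + cst z by [].
by apply: is_diff_eq; rewrite addr0.
Qed.

End AffineMaps.

(** * Smooth maps between manifolds *)

Section SmoothMaps.
Context {R : realType}.

Lemma open_setI_preimage (X Y : topologicalType) (U : set X) (A : set Y)
    (f : X -> Y) : open U -> (forall x, U x -> {for x, continuous f}) ->
  open A -> open (U `&` f @^-1` A).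
Proof.
move=> Uo fc Ao; rewrite openE => x [Ux Afx].
apply: filterI; first exact: open_nbhs_nbhs.
by apply: (fc x Ux); exact: open_nbhs_nbhs.
Qed.

(** Smoothness of a map into T from a subset of a normed space. For a real
    variable this is [smooth_curve]; for a chart domain it expresses the
    smoothness of a map between manifolds. One composition lemma then serves
    both. *)
Definition smooth_from {n} {V : normedModType R} {T : chartedType R n} (U : set V)
    (c : V -> T) : Prop :=
  (forall t, U t -> {for t, continuous c}) /\
  forall y : T, Cinfty (U `&` c @^-1` chart_dom (chart_at y)) (chart_at y \o c).

(** The part of the manifold axioms that the composition of smooth maps relies on;
    unlike the manifold structure, it is immediate for products. *)
Definition good_charts {n} (T : chartedType R n) : Prop :=
  forall x : T, [/\ chart_dom (chart_at x) x, open (chart_dom (chart_at x)) &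
    {in chart_dom (chart_at x), cancel (chart_at x) (chart_inv (chart_at x))}].

Lemma good_manifold {n} (T : manifoldType R n) : good_charts T.
Proof.
by move=> x; split; [exact: chart_at_dom|exact: chart_dom_open|exact: chart_mapK].
Qed.

Lemma good_prod {m n} (S : chartedType R m) (T : chartedType R n) :
  good_charts S -> good_charts T -> good_charts (S * T)%type.
Proof.
move=> gS gT [x y]; have [dx ox kx] := gS x; have [dy oy ky] := gT y; split.
- by [].
- rewrite openE => -[x' y'] /= [dx' dy'].
  exists (chart_dom (chart_at x), chart_dom (chart_at y)) => //.
  by split; exact: open_nbhs_nbhs.
- move=> [x' y'] /set_mem [/= dx' dy'].
  by rewrite /= row_mxKl row_mxKr kx ?ky//; exact: mem_set.
Qed.

Lemma smooth_from_sub {n} {V : normedModType R} {T : chartedType R n} (U U' : set V)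
    (c : V -> T) : U' `<=` U -> smooth_from U c -> smooth_from U' c.
Proof.
move=> UU' [cc cs]; split=> [t /UU'/cc//|y k].
by apply: Ck_sub (cs y k) => t [/UU'].
Qed.

Lemma smooth_from_ext {n} {V : normedModType R} {T : chartedType R n} (U : set V)
    (c c' : V -> T) :
  open U -> {in U, c =1 c'} -> smooth_from U c -> smooth_from U c'.
Proof.
move=> Uo cc' [cc cs].
have near_cc' t : U t -> \near t, c t = c' t.
  move=> Ut; apply: filterS (open_nbhs_nbhs (conj Uo Ut)) => s Us.
  exact/cc'/mem_set.
split=> [t Ut|y k].
  have /nbhs_singleton E := near_cc' t Ut.
  rewrite /prop_for /continuous_at -E.
  by apply: cvg_trans (cc t Ut); exact/near_eq_cvg/near_cc'.
have : Ck k (U `&` c' @^-1` chart_dom (chart_at y)) (chart_at y \o c).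
  by apply: Ck_sub (cs y k) => t [Ut /=]; rewrite -cc' ?mem_set.
apply: Ck_near => t [Ut _].
by apply: filterS (near_cc' t Ut) => s /= ->.
Qed.

Lemma smooth_from_cst {n} {V : normedModType R} {T : chartedType R n} (U : set V)
  (x : T) : smooth_from U (cst x).
Proof. by split=> [t _|y k]; [exact: cst_continuous|exact: (@Ck_cst _ _ _ k _ (chart_at y x))]. Qed.

Lemma smooth_from_chart_inv {n} {T : manifoldType R n} (x : T) :
  smooth_from (chart_at x @` chart_dom (chart_at x)) (chart_inv (chart_at x)).
Proof.
split=> [_ [y yx <-]|y k]; first exact: chart_inv_continuous.
apply: Ck_sub (@chart_transition _ _ _ x y k) => _ [[z zx <-] /=].
by rewrite chart_mapK ?mem_set// => zy; exists z.
Qed.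

Lemma smooth_from_comp_chart_inv {n} {V : normedModType R} {T : manifoldType R n}
    (U : set V) (x : T) (z : V -> 'rV[R]_n) : open U -> Cinfty U z ->
  (forall t, U t -> (chart_at x @` chart_dom (chart_at x)) (z t)) ->
  smooth_from U (chart_inv (chart_at x) \o z).
Proof.
move=> Uo zU zx; have [ic is_] := smooth_from_chart_inv x.
have cc t : U t -> {for t, continuous (chart_inv (chart_at x) \o z)}.
  move=> Ut; apply: continuous_comp; first exact: Cinfty_continuous zU Ut.
  exact/ic/zx.
split=> // y; rewrite compA; apply: Cinfty_comp (is_ y).
- by apply: open_setI_preimage => //; exact: chart_dom_open.
- by move=> t [Ut ty]; split=> //; exact: zx.
- by move=> k; apply: Ck_sub (zU k) => t [].
Qed.

(** Around t, factor F \o c through the chart at c t. *)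
Lemma smooth_from_comp {m n} {V : normedModType R} {S : chartedType R m}
    {T : chartedType R n} (U : set V) (A : set S) (c : V -> S) (F : S -> T) :
  good_charts S -> good_charts T ->
  open U -> smooth_from U c -> smooth_open A F -> (forall t, U t -> A (c t)) ->
  smooth_from U (F \o c).
Proof.
move=> gS gT Uo [cc cs] [Fc Fs] UA.
have Fcc t : U t -> {for t, continuous (F \o c)}.
  by move=> Ut; apply: continuous_comp; [exact: cc|exact/Fc/UA].
split=> // y k; have [_ oy _] := gT y.
apply: Ck_ptwise => t0 [Ut0 yt0]; set x := c t0; have [dx ox kx] := gS x.
pose N := (U `&` c @^-1` chart_dom (chart_at x)) `&`
  (U `&` (F \o c) @^-1` chart_dom (chart_at y)).
have No : open N by apply: openI; exact: open_setI_preimage.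
have NC : Cinfty N ((chart_at y \o F \o chart_inv (chart_at x)) \o
    (chart_at x \o c)).
  apply: Cinfty_comp (Fs x y) => //.
  - move=> t [[Ut tx] [_ ty]]; exists (c t) => //; split=> //; split=> //.
    exact: UA.
  - by move=> j; apply: Ck_sub (cs x j) => t [[]].
have : Ck k N (chart_at y \o (F \o c)).
  apply: (Ck_ext No) (NC k) => t /set_mem [[_ tx] _] /=.
  by rewrite kx ?mem_set.
by apply: Ck_sub => _ ->.
Qed.

Lemma smooth_from_pair {m n} {V : normedModType R} {S : chartedType R m}
    {T : chartedType R n} (U : set V) (c : V -> S) (d : V -> T) :
  good_charts S -> good_charts T ->
  open U -> smooth_from U c -> smooth_from U d ->
  smooth_from U (fun t => (c t, d t) : (S * T)%type).
Proof.
move=> gS gT Uo [cc cs] [dc ds]; split=> [t Ut|[x y] k].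
  by apply: cvg_pair; [exact: cc|exact: dc].
have [_ ox _] := gS x; have [_ oy _] := gT y.
set N := _ `&` _.
have NE : N = (U `&` c @^-1` chart_dom (chart_at x)) `&`
  (U `&` d @^-1` chart_dom (chart_at y)).
  by apply/seteqP; split=> t [] => [Ut [? ?]|[Ut ?] [_ ?]].
have No : open N by rewrite NE; apply: openI; exact: open_setI_preimage.
apply/Ck_rVP => // i; rewrite -(splitK i); case: (fintype.split i) => j /=.
  under eq_fun do rewrite row_mxEl.
  apply: ((Ck_rVP _ (fun t => chart_at x (c t)) No).1 _ j).
  by apply: Ck_sub (cs x k); rewrite NE => t [].
under eq_fun do rewrite row_mxEr.
apply: ((Ck_rVP _ (fun t => chart_at y (d t)) No).1 _ j).
by apply: Ck_sub (ds y k); rewrite NE => t [].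
Qed.

Lemma chart_img_openI {n} {T : manifoldType R n} (x : T) (A : set T) : open A ->
  open (chart_at x @` (chart_dom (chart_at x) `&` A)).
Proof.
move=> Ao.
have -> : chart_at x @` (chart_dom (chart_at x) `&` A) =
    chart_at x @` chart_dom (chart_at x) `&` chart_inv (chart_at x) @^-1` A.
  apply/seteqP; split=> [_ [y [yx Ay] <-]|_ [[y yx <-] /=]].
    by split; [exists y|rewrite /= chart_mapK ?mem_set].
  by rewrite chart_mapK ?mem_set// => Ay; exists y.
apply: open_setI_preimage => //; first exact: chart_img_open.
by move=> _ [y yx <-]; exact: chart_inv_continuous.
Qed.

(** Reduces the composition of smooth maps between manifolds to
    [smooth_from_comp], whose source is a normed space. *)
Lemma smooth_openP {m n} {S : manifoldType R m} {T : chartedType R n}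
    (A : set S) (f : S -> T) :
  smooth_open A f <-> (forall x, A x -> {for x, continuous f}) /\
  forall x : S, smooth_from (chart_at x @` (chart_dom (chart_at x) `&` A))
    (f \o chart_inv (chart_at x)).
Proof.
(* The domains appearing on both sides are the same. *)
have E (x : S) (y : T) : chart_at x @` (chart_dom (chart_at x) `&` A) `&`
    (f \o chart_inv (chart_at x)) @^-1` chart_dom (chart_at y) =
    chart_at x @` (chart_dom (chart_at x) `&` A `&` f @^-1` chart_dom (chart_at y)).
  apply/seteqP; split=> [_ [[z [zx Az] <-] /=]|_ [z [[zx Az] zy] <-]].
    by rewrite chart_mapK ?mem_set// => zy; exists z.
  by split; [exists z|rewrite /= chart_mapK ?mem_set].
split=> [[fc fs]|[fc fs]]; split=> // x.
- split=> [_ [z [zx Az] <-]|y]; last by rewrite E; exact: fs.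
  apply: continuous_comp; first exact: chart_inv_continuous.
  by rewrite chart_mapK ?mem_set//; exact: fc.
- by move=> y; rewrite -E; exact: (fs x).2.
Qed.

Lemma smooth_open_comp {m n p} {S : manifoldType R m} {T : manifoldType R n}
    {T' : manifoldType R p} (A : set S) (B : set T) (f : S -> T) (g : T -> T') :
  open A -> smooth_open A f -> smooth_open B g -> (forall x, A x -> B (f x)) ->
  smooth_open A (g \o f).
Proof.
move=> Ao /smooth_openP[fc fs] gB AB; apply/smooth_openP; split=> x.
  by move=> Ax; apply: continuous_comp; [exact: fc|exact: gB.1 _ (AB _ Ax)].
rewrite -compA; apply: smooth_from_comp gB _; try exact: good_manifold.
- exact: chart_img_openI.
- exact: fs.
- by move=> _ [z [zx Az] <-] /=; rewrite chart_mapK ?mem_set//; exact: AB.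
Qed.

Lemma smooth_open_id {m} {S : manifoldType R m} (A : set S) :
  smooth_open A (id : S -> S).
Proof.
apply/smooth_openP; split=> [x _|x]; first exact: cvg_id.
apply: (@smooth_from_sub _ _ _ (chart_at x @` chart_dom (chart_at x))).
  by move=> _ [y [yx _] <-]; exists y.
exact: smooth_from_chart_inv.
Qed.

Lemma smooth_open_cst {m n} {S : manifoldType R m} {T : manifoldType R n}
  (A : set S) (y : T) : smooth_open A (cst y : S -> T).
Proof.
apply/smooth_openP; split=> [x _|x]; first exact: cst_continuous.
exact: smooth_from_cst.
Qed.

(** With constants for f or g, this is the smoothness of the partial maps of F. *)
Lemma smooth_open_pair_comp {m n p q} {S : manifoldType R m} {T : manifoldType R n}
    {T' : manifoldType R p} {S' : manifoldType R q}
    (A : set S) (B : set (T * T')) (f : S -> T) (g : S -> T')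
    (F : (T * T')%type -> S') :
  open A -> smooth_open A f -> smooth_open A g -> smooth_open B F ->
  (forall x, A x -> B (f x, g x)) -> smooth_open A (fun x => F (f x, g x)).
Proof.
move=> Ao /smooth_openP[fc fs] /smooth_openP[gc gs] FB AB.
apply/smooth_openP; split=> x.
  move=> Ax; apply: (@continuous_comp _ _ _ (fun z => (f z, g z)) F).
    by apply: cvg_pair; [exact: fc|exact: gc].
  exact: FB.1 _ (AB _ Ax).
apply: (@smooth_from_comp _ _ _ (T * T')%type _ _ B
  (fun z => (f (chart_inv (chart_at x) z), g (chart_inv (chart_at x) z)))) => //.
- by apply: good_prod; exact: good_manifold.
- exact: good_manifold.
- exact: chart_img_openI.
- apply: smooth_from_pair; try exact: good_manifold.
  + exact: chart_img_openI.
  + exact: fs.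
  + exact: gs.
- by move=> _ [z [zx Az] <-] /=; rewrite chart_mapK ?mem_set//; exact: AB.
Qed.

Lemma smooth_open_local {m n} {S : manifoldType R m} {T : manifoldType R n}
    (A : set S) (f : S -> T) :
  (forall x, A x -> exists (N : set S) (F : S -> T),
    [/\ open N, N x, smooth_open N F & {in N, F =1 f}]) -> smooth_open A f.
Proof.
move=> H; split=> [x /H[N [F [No Nx [Fc _] Ff]]]|x y k].
  have fF : \near x, F x = f x.
    by apply: filterS (open_nbhs_nbhs (conj No Nx)) => z Nz; apply/Ff/mem_set.
  rewrite /prop_for /continuous_at -(nbhs_singleton fF).
  by apply: cvg_trans (Fc x Nx); exact/near_eq_cvg.
apply: Ck_ptwise => _ [w [[wx /H[N [F [No Nw [_ Fs] Ff]]]] wy] <-].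
have : Ck k [set chart_at x w] (chart_at y \o F \o chart_inv (chart_at x)).
  apply: Ck_sub (Fs x y k) => _ ->; exists w => //; split=> //.
  by rewrite /= Ff ?mem_set.
apply: Ck_near => _ ->.
have : nbhs (chart_inv (chart_at x) (chart_at x w)) N.
  by rewrite chart_mapK ?mem_set//; exact: open_nbhs_nbhs.
move=> /(@chart_inv_continuous _ _ _ x w wx) Nn.
have {}Nn : nbhs (chart_at x w) (chart_inv (chart_at x) @^-1` N) := Nn.
apply: filterS Nn => z Nz /=.
by rewrite Ff ?mem_set.
Qed.

End SmoothMaps.

(** * Velocities and the Maurer-Cartan form *)

Section Velocity.
Context {R : realType}.

Lemma velocity_near_eq {n} {T : chartedType R n} (c c' : R -> T) (t : R) :
  (\near t, c t = c' t) -> velocity c t = velocity c' t :> 'rV[R]_n.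
Proof.
move=> cc'; rewrite /velocity !derive1E (nbhs_singleton cc').
by apply: near_eq_derive; apply: filterS cc' => s /= ->.
Qed.

Lemma smooth_from_differentiable {n} {V : normedModType R} {T : chartedType R n}
    (U : set V) (c : V -> T) (x : T) t :
  smooth_from U c -> U t -> chart_dom (chart_at x) (c t) ->
  differentiable (chart_at x \o c) t.
Proof. by move=> [_ cs] Ut xt; exact: Cinfty_differentiable (cs x) _. Qed.

Lemma smooth_open_differentiable {m n} {S : chartedType R m} {T : chartedType R n}
    (A : set S) (f : S -> T) (x : S) (y : T) z :
  smooth_open A f -> A z -> chart_dom (chart_at x) z ->
  chart_dom (chart_at y) (f z) ->
  differentiable (chart_at y \o f \o chart_inv (chart_at x)) (chart_at x z).
Proof.
move=> [_ fs] Az zx zy; apply: Cinfty_differentiable (fs x y) _.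
by exists z.
Qed.

(** The chain rule at the point c t = x. The equation is kept as a hypothesis,
    as c t is often equal to x without being convertible to it. *)
Lemma derive1_chart_comp {m n} {S : manifoldType R m} {T : manifoldType R n}
    (U : set R) (A : set S) (c : R -> S) (f : S -> T) (x : S) (t : R) :
  open U -> smooth_from U c -> U t -> smooth_open A f -> A x -> c t = x ->
  derive1 (chart_at (f x) \o (f \o c)) t =
  @tmap _ _ _ S T f x (derive1 (chart_at x \o c) t).
Proof.
move=> Uo cU Ut fA Ax cx.
have dc : differentiable (chart_at x \o c) t.
  by apply: smooth_from_differentiable cU Ut _; rewrite cx; exact: chart_at_dom.
have df : differentiable (chart_at (f x) \o f \o chart_inv (chart_at x))
    ((chart_at x \o c) t).
  by rewrite /= cx; apply: smooth_open_differentiable fA Ax _ _; exact: chart_at_dom.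
have E : \near t, ((chart_at (f x) \o f \o chart_inv (chart_at x)) \o
    (chart_at x \o c)) t = (chart_at (f x) \o (f \o c)) t.
  have : nbhs (c t) (chart_dom (chart_at x)).
    rewrite cx; apply: open_nbhs_nbhs; split; first exact: chart_dom_open.
    exact: chart_at_dom.
  move=> /(cU.1 t Ut) Nc.
  have {}Nc : nbhs t (c @^-1` chart_dom (chart_at x)) := Nc.
  by apply: filterS Nc => s /= sx; rewrite chart_mapK ?mem_set.
rewrite derive1E -(near_eq_derive _ E) deriveE; last exact: differentiable_comp.
by rewrite (diff_comp dc df) /tmap (derive1E' dc) /= cx.
Qed.

Lemma velocity_comp {m n} {S : manifoldType R m} {T : manifoldType R n}
    (U : set R) (A : set S) (c : R -> S) (f : S -> T) (t : R) :
  open U -> smooth_from U c -> U t -> smooth_open A f -> A (c t) ->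
  velocity (f \o c) t = tmap f (velocity c t).
Proof. by move=> Uo cU Ut fA Ac; exact: derive1_chart_comp Uo cU Ut fA Ac _. Qed.

Lemma smooth_from_affine {n} {T : manifoldType R n} (U : set R) (c : R -> T)
    (a b : R) : open U -> smooth_from U c ->
  smooth_from [set t | U (a * t + b)] (fun t => c (a * t + b)).
Proof.
move=> Uo [cc cs]; have da := is_diff_affine a b.
have ac : continuous (fun t : R => a * t + b).
  by move=> t; exact/differentiable_continuous.
split=> [t Ut|y k].
  apply: (@continuous_comp _ _ _ (fun t => a * t + b)); first exact: ac.
  exact: cc.
apply: Ck_sub (Ck_affine da _ (cs y k)) => // .
by apply: open_setI_preimage => //; exact: chart_dom_open.
Qed.

Lemma velocity_affine {n} {T : manifoldType R n} (U : set R) (c : R -> T)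
    (a b t : R) : open U -> smooth_from U c -> U (a * t + b) ->
  velocity (fun s => c (a * s + b)) t = a *: velocity c (a * t + b).
Proof.
move=> Uo cU Ut; rewrite /velocity.
have dc : differentiable (chart_at (c (a * t + b)) \o c) (a * t + b).
  by apply: smooth_from_differentiable cU Ut _; exact: chart_at_dom.
have [_] := derive_affine (1 : R) (is_diff_affine a b t) dc.
rewrite derive1E => ->.
by rewrite (deriveE _ dc) (diff1E dc) mulr1.
Qed.

End Velocity.

Section LieCurves.
Context {R : realType} {n : nat} (G : lieGroupType R n).

Lemma smooth_lmul (g : G) : smooth (fun x : G => (g * x)%g).
Proof.
apply: (@smooth_open_pair_comp _ _ _ _ _ _ _ _ _ _ _ (cst g) id
  (fun x : (G * G)%type => (x.1 * x.2)%g) _ _ _ lie_mul_smooth) => //.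
- exact: openT.
- exact: smooth_open_cst.
- exact: smooth_open_id.
Qed.

Lemma smooth_rmul (g : G) : smooth (fun x : G => (x * g)%g).
Proof.
apply: (@smooth_open_pair_comp _ _ _ _ _ _ _ _ _ _ _ id (cst g)
  (fun x : (G * G)%type => (x.1 * x.2)%g) _ _ _ lie_mul_smooth) => //.
- exact: openT.
- exact: smooth_open_id.
- exact: smooth_open_cst.
Qed.

Lemma smooth_conj (g : G) : smooth (fun x : G => (g * x * g^-1)%g).
Proof. 
exact: (smooth_open_comp openT (smooth_lmul g) (smooth_rmul (g^-1)%g)).
Qed.

(** The Maurer-Cartan form of a velocity is the velocity at the identity of the
    translated curve. Its behaviour under translations and conjugations is then
    visible on the right-hand side. *)
Lemma maurer_cartan_velocity (U : set R) (c : R -> G) t :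
  open U -> smooth_from U c -> U t ->
  maurer_cartan (velocity c t) =
  derive1 (chart_at (1%g : G) \o (fun s => (c t)^-1 * c s)%g) t.
Proof.
move=> Uo cU Ut; rewrite /maurer_cartan.
have := velocity_comp Uo cU Ut (smooth_lmul ((c t)^-1)%g) I.
by rewrite /velocity /= mulVg => <-.
Qed.

Lemma maurer_cartan_lmul (U : set R) (c : R -> G) t (g : G) :
  open U -> smooth_from U c -> U t ->
  maurer_cartan (velocity (fun s => g * c s)%g t) = maurer_cartan (velocity c t).
Proof.
move=> Uo cU Ut; rewrite (maurer_cartan_velocity Uo cU Ut).
have gU : smooth_from U (fun s => g * c s)%g.
  apply: smooth_from_comp (smooth_lmul g) _ => //; exact: good_manifold.
rewrite (maurer_cartan_velocity Uo gU Ut); congr (derive1 (_ \o _) t).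
by apply/funext => s; rewrite invgM -mulgA mulKg.
Qed.

Lemma maurer_cartan_conj (U : set R) (c : R -> G) t (g : G) :
  open U -> smooth_from U c -> U t ->
  maurer_cartan (velocity (fun s => g * c s * g^-1)%g t) =
  Ad g (maurer_cartan (velocity c t)).
Proof.
move=> Uo cU Ut; rewrite (maurer_cartan_velocity Uo cU Ut).
have gU : smooth_from U (fun s => g * c s * g^-1)%g.
  apply: smooth_from_comp (smooth_conj g) _ => //; exact: good_manifold.
rewrite (maurer_cartan_velocity Uo gU Ut) /Ad.
have kU : smooth_from U (fun s => (c t)^-1 * c s)%g.
  apply: smooth_from_comp (smooth_lmul ((c t)^-1)%g) _ => //; exact: good_manifold.
rewrite -(derive1_chart_comp Uo kU Ut (smooth_conj g))//; last exact: mulVg.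
rewrite mulg1 mulgV; congr (derive1 (_ \o _) t).
apply/funext => s /=; rewrite !invgM invgK !mulgA.
by rewrite -(mulgA _ g^-1%g g) mulVg mulg1.
Qed.

Lemma maurer_cartan_affine (U : set R) (c : R -> G) (a b t : R) :
  open U -> smooth_from U c -> U (a * t + b) ->
  maurer_cartan (velocity (fun s => c (a * s + b)) t) =
  a *: maurer_cartan (velocity c (a * t + b)).
Proof.
by move=> Uo cU Ut; rewrite (velocity_affine Uo cU Ut) /maurer_cartan /tmap linearZ.
Qed.

End LieCurves.

(** * Piecewise smooth paths *)

Section Piecewise.
Context {R : realType} {n : nat} {T : manifoldType R n}.
Implicit Types c : R -> T.

Definition smooth_arc (a b : R) c : Prop := exists (U : set R) (c' : R -> T),
  [/\ open U, `[a, b]%classic `<=` U, smooth_curve U c' & {in `[a, b]%classic, c' =1 c}].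

(** [piecewise_smooth] on an arbitrary interval, the partition being implicit in
    the derivation, so that induction replaces the handling of indices. *)
Inductive pw_smooth c : R -> R -> Prop :=
| pw_arc a b : a < b -> smooth_arc a b c -> pw_smooth c a b
| pw_cons a b d : a < b -> smooth_arc a b c -> pw_smooth c b d -> pw_smooth c a d.

Lemma piecewise_smoothP c : piecewise_smooth c <-> pw_smooth c 0 1.
Proof.
split=> [[s [ps /eqP ls]]|].
  have s0 : s != [::].
    by apply/eqP => s0; move: ls; rewrite s0 /= => /eqP; rewrite eq_sym oner_eq0.
  suff H (a : R) : path <%R a s ->
      (forall i, (i < size s)%N ->
       smooth_arc (nth 0 (a :: s) i) (nth 0 (a :: s) i.+1) c) ->
      pw_smooth c a (last a s).
    by rewrite -ls => Hs; apply: H => // i /Hs.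
  elim: s s0 a {ps ls} => // b s IH _ a /= /andP[ab bs] H.
  have ab_arc : smooth_arc a b c := H 0%N isT.
  case: s IH bs H => [|d s] IH bs H; first exact: pw_arc.
  apply: pw_cons ab ab_arc (IH isT _ bs _) => i si.
  exact: (H i.+1).
suff H a b : pw_smooth c a b -> exists2 s : seq R, itv_partition a b s &
    forall i, (i < size s)%N ->
    smooth_arc (nth 0 (a :: s) i) (nth 0 (a :: s) i.+1) c.
  by move=> /H[s s1 s2]; exists s => // i /s2.
elim=> {a b} [a b ab abc|a b d ab abc _ [s [ps ls] Hs]].
  exists [:: b]; first by split=> //=; rewrite ab.
  by case.
exists (b :: s); first by split=> //=; rewrite ab.
by case=> [|i] //=; rewrite ltnS; exact: Hs.
Qed.

Lemma pw_lt c a b : pw_smooth c a b -> a < b.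
Proof. by elim=> // {}a {}b d ab _ _; exact: lt_trans. Qed.

Lemma pw_trans c a b d : pw_smooth c a b -> pw_smooth c b d -> pw_smooth c a d.
Proof.
elim=> {a b} [a b ab abc|a b e ab abc _ IH] H; first exact: pw_cons abc H.
exact: pw_cons abc (IH H).
Qed.

Lemma smooth_arc_sub c c' a b : smooth_arc a b c ->
  {in `[a, b]%classic, c =1 c'} -> smooth_arc a b c'.
Proof.
move=> [U [d [Uo abU dU dc]]] cc'; exists U, d; split=> // t tab.
by rewrite dc// cc'.
Qed.

Lemma pw_ext c c' a b : pw_smooth c a b -> {in `[a, b]%classic, c =1 c'} ->
  pw_smooth c' a b.
Proof.
elim=> {a b} [a b ab abc|a b d ab abc bd IH] cc'.
  exact: pw_arc (smooth_arc_sub abc cc').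
have lbd := pw_lt bd.
apply: (pw_cons ab _ (IH _)).
  apply: smooth_arc_sub abc _ => t /set_mem/=; rewrite in_itv/= => /andP[at_ tb].
  by apply/cc'/mem_set => /=; rewrite in_itv/= at_ (le_trans tb (ltW lbd)).
move=> t /set_mem/=; rewrite in_itv/= => /andP[bt td].
by apply/cc'/mem_set => /=; rewrite in_itv/= td (le_trans (ltW ab) bt).
Qed.

Lemma smooth_arc_affine c a b k e x y : smooth_arc a b c ->
  (forall t, x <= t <= y -> a <= k * t + e <= b) ->
  smooth_arc x y (fun t => c (k * t + e)).
Proof.
move=> [U [d [Uo abU dU dc]]] xy.
exists [set t | U (k * t + e)], (fun t => d (k * t + e)); split.
- apply: (@open_comp _ _ (fun t : R => k * t + e)) => // t _.
  exact/differentiable_continuous/(ex_diff (is_diff_def := is_diff_affine k e t)).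
- by move=> t /=; rewrite in_itv/= => /xy tab; apply: abU => /=; rewrite in_itv.
- exact: smooth_from_affine.
- move=> t /set_mem/=; rewrite in_itv/= => /xy tab; apply/dc/mem_set => /=.
  by rewrite in_itv.
Qed.

Lemma pw_affine_pos c a b k e : 0 < k -> pw_smooth c a b ->
  pw_smooth (fun t => c (k * t + e)) ((a - e) / k) ((b - e) / k).
Proof.
move=> k0; have H x y : x < y -> smooth_arc x y c -> (x - e) / k < (y - e) / k /\
    smooth_arc ((x - e) / k) ((y - e) / k) (fun t => c (k * t + e)).
  move=> xy xyc; split; first by rewrite ltr_pM2r ?invr_gt0// ltrD2r.
  apply: smooth_arc_affine xyc _ => t.
  by rewrite ler_pdivrMr// ler_pdivlMr// mulrC lerBlDr lerBrDr.
elim=> {a b} [a b ab abc|a b d ab abc _ IH]; have [? ?] := H _ _ ab abc.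
  exact: pw_arc.
by apply: pw_cons IH.
Qed.

Lemma pw_reverse c a b e : pw_smooth c a b ->
  pw_smooth (fun t => c (-1 * t + e)) (e - b) (e - a).
Proof.
have H x y : x < y -> smooth_arc x y c -> e - y < e - x /\
    smooth_arc (e - y) (e - x) (fun t => c (-1 * t + e)).
  move=> xy xyc; split; first by lra.
  by apply: smooth_arc_affine xyc _ => t ?; lra.
elim=> {a b} [a b ab abc|a b d ab abc _ IH]; have [? ?] := H _ _ ab abc.
  exact: pw_arc.
by apply: pw_trans IH _; exact: pw_arc.
Qed.

(** A path is regular at t when it is smooth near t; a piecewise smooth path is so
    away from finitely many times, where the chain rule is not available. *)
Definition regular c t := exists U : set R, [/\ open U, U t & smooth_from U c].

Lemma regular_near_eq c c' t : (\near t, c t = c' t) -> regular c t ->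
  regular c' t.
Proof.
move=> cc' [U [Uo Ut cU]]; pose V := [set s | c s = c' s]^°.
have Vo : open V by exact: open_interior.
have Vt : V t by exact: cc'.
have Vcc' : V `<=` [set s | c s = c' s] by exact: interior_subset.
exists (U `&` V); split=> //; first exact: openI.
apply: smooth_from_ext (smooth_from_sub _ cU); first exact: openI.
  by move=> s /set_mem[_ /Vcc'].
exact: subIsetl.
Qed.

Lemma regular_affine c k e t : regular c (k * t + e) ->
  regular (fun t => c (k * t + e)) t.
Proof.
move=> [U [Uo Ut cU]]; exists [set t | U (k * t + e)]; split=> //.
- apply: (@open_comp _ _ (fun t : R => k * t + e)) => // s _.
  exact/differentiable_continuous/(ex_diff (is_diff_def := is_diff_affine k e s)).
- exact: smooth_from_affine.
Qed.

Lemma smooth_arc_regular c a b t : smooth_arc a b c -> a < t < b -> regular c t.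
Proof.
move=> [U [c' [Uo abU cU c'c]]] atb.
have tab : t \in `]a, b[ by rewrite in_itv.
apply: (@regular_near_eq c').
  apply: filterS (near_in_itvoo tab) => s; rewrite in_itv/= => /andP[as_ sb].
  by apply/c'c/mem_set => /=; rewrite in_itv/= !ltW.
exists U; split=> //; apply: abU => /=; rewrite in_itv/=.
by move: atb => /andP[? ?]; rewrite !ltW.
Qed.

Lemma pw_regular c a b : pw_smooth c a b ->
  exists s : seq R, forall t, a < t < b -> t \notin s -> regular c t.
Proof.
elim=> {a b} [a b ab abc|a b d ab abc bd [s Hs]].
  by exists [::] => t atb _; exact: smooth_arc_regular abc atb.
exists (b :: s) => t /andP[at_ td]; rewrite inE negb_or => /andP[tb ts].
have [tb'|bt|E] := ltgtP t b.
- by apply: smooth_arc_regular abc _; rewrite at_.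
- by apply: Hs => //; rewrite bt.
- by rewrite E eqxx in tb.
Qed.

End Piecewise.

Lemma pw_comp {R : realType} {m n} {S : manifoldType R m} {T : manifoldType R n}
    (f : S -> T) (c : R -> S) a b : smooth f -> pw_smooth c a b ->
  pw_smooth (f \o c) a b.
Proof.
move=> fs; have H x y : smooth_arc x y c -> smooth_arc x y (f \o c).
  move=> [U [d [Uo xyU dU dc]]]; exists U, (f \o d); split=> //.
    by apply: smooth_from_comp fs _ => //; exact: good_manifold.
  by move=> t txy /=; rewrite dc.
elim=> {a b} [a b ab /H abc|a b d ab /H abc _ IH]; first exact: pw_arc.
exact: pw_cons IH.
Qed.

Lemma regular_comp {R : realType} {m n} {S : manifoldType R m} {T : manifoldType R n}
    (f : S -> T) (c : R -> S) t : smooth f -> regular c t -> regular (f \o c) t.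
Proof.
move=> fs [U [Uo Ut cU]]; exists U; split=> //.
by apply: smooth_from_comp fs _ => //; exact: good_manifold.
Qed.

(** * The groupoid of developments *)

Section Groupoid.
Context {R : realType} {n p d : nat} {G : lieGroupType R n}
  {H : modelGeometry G} {P : manifoldType R p} {M : manifoldType R d}.
Variable C : cartanGeometry H P M.

Let H1 : H 1%g. Proof. by have [] := closed_subgroupP H. Qed.
Let HM x y : H x -> H y -> H (x * y)%g.
Proof. by have [_ + _] := closed_subgroupP H; apply. Qed.
Let HV x : H x -> H x^-1%g.
Proof. by have [_ _] := closed_subgroupP H; apply. Qed.

(** The action is only smooth on P x H in the sense of local extensions to open
    sets of P x G; slicing such an extension at h gives smoothness of the
    translation. *)
Lemma smooth_act h : H h -> smooth (fun u => act C u h).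
Proof.
move=> Hh; apply: smooth_open_local => u _.
have [U [F [Uo Uu Fs FE]]] := act_smooth C (conj I Hh : ([set: P] `*` H) (u, h)).
have ic : continuous (fun w : P => (w, h)).
  by move=> w; apply: cvg_pair; [exact: cvg_id|exact: cvg_cst].
exists [set w | U (w, h)], (fun w => F (w, h)).
have No : open [set w | U (w, h)] by exact: (open_comp _ Uo).
split=> //.
- apply: (@smooth_open_pair_comp _ _ _ _ _ _ _ _ _ _ U id (cst h) F) => //.
  + exact: smooth_open_id.
  + exact: smooth_open_cst.
- by move=> w /set_mem Uw; rewrite FE//; apply/mem_set.
Qed.

Definition develops_at (c : R -> P) (cG : R -> G) (t : R) : Prop :=
  [/\ regular c t, regular cG t &
    omega C (c t) (velocity c t) = maurer_cartan (velocity cG t)].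

(** The path c in P and the path cG in G have equal pullbacks, up to finitely many
    times. No normalization of cG at a is imposed, so that the notion is
    invariant under left translations and can be cut and pasted. *)
Definition develops_on (a b : R) (c : R -> P) (cG : R -> G) : Prop :=
  [/\ pw_smooth c a b, pw_smooth cG a b &
   exists s : seq R, forall t, a < t < b -> t \notin s -> develops_at c cG t].

Lemma develops_at_near_eq c c' cG cG' t : (\near t, c t = c' t) ->
  (\near t, cG t = cG' t) -> develops_at c cG t -> develops_at c' cG' t.
Proof.
move=> E EG [rc rcG cE]; split.
- exact: regular_near_eq rc.
- exact: regular_near_eq rcG.
- rewrite -(nbhs_singleton E) /maurer_cartan -(nbhs_singleton EG).
  by rewrite -(velocity_near_eq E) -(velocity_near_eq EG).
Qed.

Lemma develops_on_ext a b c c' cG cG' : {in `[a, b]%classic, c =1 c'} ->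
  {in `[a, b]%classic, cG =1 cG'} -> develops_on a b c cG -> develops_on a b c' cG'.
Proof.
move=> E EG [pc pcG [s Hs]]; split; [exact: pw_ext pc E|exact: pw_ext pcG EG|].
exists s => t tab ts; apply: develops_at_near_eq (Hs t tab ts).
  have {}tab : t \in `]a, b[ by rewrite in_itv.
  apply: filterS (near_in_itvoo tab) => r; rewrite in_itv/= => /andP[ar rb].
  by apply/E/mem_set => /=; rewrite in_itv/= !ltW.
have {}tab : t \in `]a, b[ by rewrite in_itv.
apply: filterS (near_in_itvoo tab) => r; rewrite in_itv/= => /andP[ar rb].
by apply/EG/mem_set => /=; rewrite in_itv/= !ltW.
Qed.

Lemma develops_on_trans a b e c cG :
  develops_on a b c cG -> develops_on b e c cG -> develops_on a e c cG.
Proof.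
move=> [pc pcG [s Hs]] [pc' pcG' [s' Hs']]; split.
- exact: pw_trans pc pc'.
- exact: pw_trans pcG pcG'.
- (* The junction b is an exceptional time. *)
  exists (b :: s ++ s') => t /andP[at_ te].
  rewrite inE mem_cat !negb_or => /and3P[tb ts ts'].
  have [tb'|bt|E] := ltgtP t b.
  + by apply: Hs => //; rewrite at_.
  + by apply: Hs' => //; rewrite bt.
  + by rewrite E eqxx in tb.
Qed.

Lemma develops_at_affine c cG k e t : develops_at c cG (k * t + e) ->
  develops_at (fun t => c (k * t + e)) (fun t => cG (k * t + e)) t.
Proof.
move=> [rc rcG E]; split; [exact: regular_affine|exact: regular_affine|].
have [U [Uo Ut cU]] := rc; have [V [Vo Vt cV]] := rcG.
by rewrite (velocity_affine Uo cU Ut) linearZ E (maurer_cartan_affine Vo cV Vt).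
Qed.

Lemma develops_on_affine a b c cG k e : 0 < k -> develops_on a b c cG ->
  develops_on ((a - e) / k) ((b - e) / k)
    (fun t => c (k * t + e)) (fun t => cG (k * t + e)).
Proof.
move=> k0 [pc pcG [s Hs]]; split; [exact: pw_affine_pos|exact: pw_affine_pos|].
exists [seq (x - e) / k | x <- s] => t /andP[at_ tb] ts; apply: develops_at_affine.
apply: Hs.
  move: at_ tb; rewrite ltr_pdivrMr// ltr_pdivlMr// ltrBlDr ltrBrDr.
  by rewrite mulrC => -> ->.
apply: contra ts => ts; apply/mapP; exists (k * t + e) => //.
by rewrite addrK mulrAC mulfV ?mul1r// gt_eqF.
Qed.

Lemma develops_on_reverse a b c cG e : develops_on a b c cG ->
  develops_on (e - b) (e - a) (fun t => c (-1 * t + e)) (fun t => cG (-1 * t + e)).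
Proof.
move=> [pc pcG [s Hs]]; split; [exact: pw_reverse|exact: pw_reverse|].
exists [seq e - x | x <- s] => t /andP[at_ tb] ts; apply: develops_at_affine.
apply: Hs; first by lra.
apply: contra ts => ts; apply/mapP; exists (-1 * t + e) => //.
by rewrite mulN1r opprD opprK addrCA subrr addr0.
Qed.

Lemma develops_on_lmul a b c cG g : develops_on a b c cG ->
  develops_on a b c (fun t => g * cG t)%g.
Proof.
move=> [pc pcG [s Hs]]; split=> //.
  exact: pw_comp (smooth_lmul g) pcG.
exists s => t tab ts; have [rc rcG E] := Hs t tab ts; split=> //.
  exact: regular_comp (smooth_lmul g) rcG.
by have [U [Uo Ut cU]] := rcG; rewrite (maurer_cartan_lmul _ Uo cU Ut).
Qed.

(** Both omega and the Maurer-Cartan form are transformed by Ad h^-1. *)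
Lemma develops_on_act a b c cG h : H h -> develops_on a b c cG ->
  develops_on a b (fun t => act C (c t) h) (fun t => h^-1 * cG t * h)%g.
Proof.
move=> Hh [pc pcG [s Hs]].
have -> : (fun t => h^-1 * cG t * h)%g = (fun t => h^-1 * cG t * h^-1^-1)%g.
  by apply/funext => t; rewrite invgK.
split.
- exact: pw_comp (smooth_act Hh) pc.
- exact: pw_comp (smooth_conj (h^-1)%g) pcG.
exists s => t tab ts; have [rc rcG E] := Hs t tab ts; split.
- exact: regular_comp (smooth_act Hh) rc.
- exact: regular_comp (smooth_conj (h^-1)%g) rcG.
have [U [Uo Ut cU]] := rc; have [V [Vo Vt cV]] := rcG.
rewrite (maurer_cartan_conj _ Vo cV Vt) -E -(omega_equivariant C Hh).
congr (omega C _ _).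
exact: (velocity_comp Uo cU Ut (smooth_act Hh) I).
Qed.

Lemma develops_on_aut a b c cG phi : automorphism C phi -> develops_on a b c cG ->
  develops_on a b (phi \o c) cG.
Proof.
move=> [_ phis _ phiE] [pc pcG [s Hs]]; split=> //; first exact: pw_comp.
exists s => t tab ts; have [rc rcG E] := Hs t tab ts; split=> //.
  exact: regular_comp.
have [U [Uo Ut cU]] := rc.
by rewrite (velocity_comp Uo cU Ut phis I) phiE.
Qed.

(** Developments on any interval and with any starting point in G can be used:
    reparametrize to [0, 1] and translate cG by the inverse of its initial
    value. *)
Lemma is_development_ofP u u' g : is_development_of C u u' g <->
  exists a b c cG h, [/\ develops_on a b c cG, H h, c a = u, act C (c b) h = u' &
    ((cG a)^-1 * cG b * h)%g = g].
Proof.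
split.
  move=> [c [cG [h [[/piecewise_smoothP pc [/piecewise_smoothP pcG cG0 [s Hs]] Hh]
    [c0 c1 <-]]]]].
  exists 0, 1, c, cG, h; split=> //; last by rewrite cG0 invg1 mul1g.
  split=> //; have [s1 r1] := pw_regular pc; have [s2 r2] := pw_regular pcG.
  exists (s ++ s1 ++ s2) => t t01.
  rewrite !mem_cat !negb_or => /and3P[ts ts1 ts2].
  by split; [exact: r1|exact: r2|exact: Hs].
move=> [a [b [c [cG [h [cD Hh ca cb gE]]]]]].
have ab : a < b by case: cD => /pw_lt.
pose f (t : R) := (b - a) * t + a.
have ba0 : 0 < b - a by rewrite subr_gt0.
have [pc pcG [s Hs]] := develops_on_lmul (cG a)^-1%g (develops_on_affine a ba0 cD).
rewrite subrr mul0r divff ?gt_eqF// in pc pcG Hs.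
exists (c \o f), (fun t => (cG a)^-1 * cG (f t))%g, h; split; split=> //.
- exact/piecewise_smoothP.
- split; first exact/piecewise_smoothP.
    by rewrite /f mulr0 add0r mulVg.
  by exists s => t t01 ts; have [] := Hs t t01 ts.
- by rewrite /f /= mulr0 add0r.
- by rewrite /f /= mulr1 subrK.
- by rewrite /f mulr1 subrK.
Qed.

(** Witnessed by constant paths. *)
Lemma development_fiber u h : H h -> is_development_of C u (act C u h) h.
Proof.
move=> Hh; apply/is_development_ofP; exists 0, 1, (cst u), (cst 1%g), h; split=> //.
  have arc m (T : manifoldType R m) (x : T) : pw_smooth (cst x : R -> T) 0 1.
    apply: pw_arc => //; exists setT, (cst x); split=> //; first exact: openT.
    exact: smooth_from_cst.
  have reg m (T : manifoldType R m) (x : T) t : regular (cst x : R -> T) t.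
    by exists setT; split=> //; [exact: openT|exact: smooth_from_cst].
  split; [exact: arc|exact: arc|exists [::] => t _ _; split; [exact: reg|exact: reg|]].
  have v0 m (T : manifoldType R m) (x : T) : velocity (cst x : R -> T) t = 0.
    exact: (@derive1_cst R _ (chart_at x x) t).
  by rewrite !v0 linear0 /maurer_cartan /tmap linear0.
by rewrite invg1 !mul1g.
Qed.

(** The second path starts at u' = (c b) h rather than at c b, so it is first moved
    by h^-1, which conjugates its development by h. *)
Lemma development_trans u u' u'' g g' : is_development_of C u u' g ->
  is_development_of C u' u'' g' -> is_development_of C u u'' (g * g')%g.
Proof.
move=> /is_development_ofP[a [b [c [cG [h [cD Hh ca cb <-]]]]]].
move=> /is_development_ofP[a' [b' [c' [cG' [h' [cD' Hh' ca' cb' <-]]]]]].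
apply/is_development_ofP.
have Hh1 := HV Hh.
(* g0 makes the translated second development start where the first ends. *)
pose e := a' - b; pose g0 := (cG b * h * (cG' a')^-1 * h^-1)%g.
pose k t := act C (c' (1 * t + e)) (h^-1)%g.
pose kG t := (g0 * (h * cG' (1 * t + e)%R * h^-1))%g.
pose b2 := b' - e.
have kD : develops_on b b2 k kG.
  have := develops_on_lmul g0 (develops_on_act Hh1 (develops_on_affine e ltr01 cD')).
  rewrite invgK !divr1 /b2 /k /kG /e.
  by have -> : a' - (a' - b) = b by lra.
have be : 1 * b + e = a' by rewrite /e; lra.
have b2e : 1 * b2 + e = b' by rewrite /b2; lra.
have db : k b = c b.
  by rewrite /k be ca' -cb -actM// mulgV act1.
have dGb : kG b = cG b.
  by rewrite /kG be /g0 !mulgA mulgVK mulgVK mulgK.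
have ab : a < b by case: cD => /pw_lt.
have bb2 : b < b2 by case: kD => /pw_lt.
exists a, b2, (fun t => if t <= b then c t else k t),
  (fun t => if t <= b then cG t else kG t), (h * h')%g; split.
- apply: (@develops_on_trans _ b).
    apply: develops_on_ext cD => t /set_mem/=; rewrite in_itv/= => /andP[_ ->//].
  apply: develops_on_ext kD => t /set_mem/=; rewrite in_itv/= => /andP[bt _].
    by case: (leP t b) => // tb; have -> : t = b by apply/le_anti/andP.
  by case: (leP t b) => // tb; have -> : t = b by apply/le_anti/andP.
- exact: HM.
- by rewrite ltW.
- rewrite leNgt bb2/= /k b2e -cb' -actM//; last exact: HM.
  by rewrite mulgA mulVg mul1g.
- rewrite (ltW ab) (leNgt b2) bb2/= /kG b2e /g0 !mulgA.
  by rewrite !(mulgVK, mulgK).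
Qed.

(** The reversed path ends at u' h^-1; moving it by h makes it start at u'. *)
Lemma development_inv u u' g : is_development_of C u u' g ->
  is_development_of C u' u g^-1%g.
Proof.
move=> /is_development_ofP[a [b [c [cG [h [cD Hh ca cb <-]]]]]].
have := develops_on_act Hh (develops_on_reverse (a + b) cD).
have -> : a + b - b = a by lra.
have -> : a + b - a = b by lra.
set k := fun t => _; set kG := fun t => _ => kD.
apply/is_development_ofP; exists a, b, k, kG, (h^-1)%g.
have ea : -1 * a + (a + b) = b by lra.
have eb : -1 * b + (a + b) = a by lra.
split=> //; first exact: HV.
- by rewrite /k ea.
- by rewrite /k eb ca -actM//; [rewrite mulgV act1|exact: HV].
- by rewrite /kG ea eb !invgM !invgK !mulgA !(mulgVK, mulgK).
Qed.

Lemma development_aut phi u u' g : automorphism C phi ->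
  is_development_of C u u' g -> is_development_of C (phi u) (phi u') g.
Proof.
move=> aphi /is_development_ofP[a [b [c [cG [h [cD Hh ca cb gE]]]]]].
apply/is_development_ofP; exists a, b, (phi \o c), cG, h; split=> //.
- exact: develops_on_aut.
- by rewrite /= ca.
- by have [_ _ <-// _] := aphi; rewrite cb.
Qed.

End Groupoid.

(** * The Picard-Lindelof theorem *)

Section Picard.
Context {R : realType} {n : nat}.
Implicit Types f g : R -> 'rV[R]_n.

Lemma ler_rV_norm (v : 'rV[R]_n) (K : R) : 0 <= K ->
  (forall i, `|v 0 i| <= K) -> `|v| <= K.
Proof.
move=> K0 vK; rewrite /Num.Def.normr/= mx_normrE (bigmax_le _ K0)//= => -[i j] _.
by rewrite ord1.
Qed.

Lemma rV_norm_coord (v : 'rV[R]_n) i : `|v 0 i| <= `|v|.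
Proof.
rewrite [leRHS]/Num.Def.normr/= mx_normrE.
by apply: (le_bigmax _ (fun ij : 'I_1 * 'I_n => `|v ij.1 ij.2|) (0, i)).
Qed.

(** For r >= 0, the retraction of the line onto [- r, r]. It turns data defined
    near a point into globally defined Lipschitz data. *)
Definition clamp (r t : R) : R := Num.max (- r) (Num.min r t).

Lemma clamp_id r t : - r <= t <= r -> clamp r t = t.
Proof. by move=> /andP[h1 h2]; rewrite /clamp min_r// max_r. Qed.

Lemma clamp_itv r t : 0 <= r -> - r <= clamp r t <= r.
Proof. by move=> r0; rewrite /clamp le_max lexx/= ge_max ge_min lexx !andbT; lra. Qed.

Lemma clamp_lip r s t : `|clamp r t - clamp r s| <= `|t - s|.
Proof.
wlog st : s t / s <= t => [H|].
  by have [/H//|/ltW/H] := leP s t; rewrite distrC (distrC s).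
rewrite (@ger0_norm _ (t - s)) ?subr_ge0//.
rewrite /clamp; case: (leP r t) => h1; case: (leP r s) => h2;
  case: (leP (- r) r) => h3; case: (leP (- r) s) => h4;
  case: (leP (- r) t) => h5; rewrite ler_norml; lra.
Qed.

Lemma lip_continuous (V W : normedModType R) (f : V -> W) (K : R) :
  (forall s t, `|f t - f s| <= K * `|t - s|) -> continuous f.
Proof.
move=> fK t; apply/cvgrPdist_lt => e e0.
have K1 : 0 < `|K| + 1 by rewrite ltr_pwDr.
near=> s.
apply: le_lt_trans (fK s t) _.
apply: (@le_lt_trans _ _ ((`|K| + 1) * `|t - s|)).
  by rewrite ler_wpM2r// (le_trans (ler_norm _))// lerDl.
rewrite mulrC -ltr_pdivlMr//; near: s.
have eK0 : 0 < e / (`|K| + 1) by rewrite divr_gt0.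
by apply: (@cvgr_dist_lt _ _ _ (nbhs t) _ id t) => //; exact: cvg_id.
Unshelve. all: by end_near. Qed.

Lemma clamp_continuous r : continuous (clamp r).
Proof.
apply: (@lip_continuous _ R^o _ 1) => s t; rewrite mul1r; exact: clamp_lip.
Qed.

(** Used to pass to the limit in estimates along the Picard iterates without
    speaking of limits. *)
Lemma archi_le (x y D : R) : (forall k : nat, x <= y + D / 2 ^+ k) -> x <= y.
Proof.
move=> H; rewrite leNgt; apply/negP => yx.
have e0 : 0 < x - y by rewrite subr_gt0.
have [k Dk] : exists k : nat, D / (x - y) < k%:R.
  exists (Num.bound `|D / (x - y)|).
  exact: le_lt_trans (ler_norm _) (archi_boundP (normr_ge0 _)).
have := H k; apply/negP; rewrite -ltNge -ltrBrDl.
rewrite ltr_pdivrMr ?exprn_gt0//.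
rewrite ltr_pdivrMr// in Dk; apply: lt_le_trans Dk _.
rewrite mulrC ler_pM2l// -natrX ler_nat.
exact/ltnW/ltn_expl.
Qed.

(** The sequences u k - 2 D / 2 ^+ k and u k + 2 D / 2 ^+ k are monotone and
    adjacent; take the supremum of the first. *)
Lemma fast_cauchy (u : nat -> R) (D : R) :
  (forall k, `|u k.+1 - u k| <= D / 2 ^+ k) ->
  exists l, forall k, `|l - u k| <= 2 * D / 2 ^+ k.
Proof.
move=> uD; pose a k := u k - 2 * D / 2 ^+ k; pose b k := u k + 2 * D / 2 ^+ k.
have half k : 2 * D / 2 ^+ k.+1 = D / 2 ^+ k.
  by rewrite exprS invfM mulrA [2 * D]mulrC mulfK.
have twice k : 2 * D / 2 ^+ k = 2 * (D / 2 ^+ k) by rewrite mulrA.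
have D0 k : 0 <= D / 2 ^+ k by apply: le_trans (uD k).
have aS k : a k <= a k.+1.
  by have := uD k; rewrite /a half twice ler_norml => /andP[]; lra.
have bS k : b k.+1 <= b k.
  by have := uD k; rewrite /b half twice ler_norml => /andP[]; lra.
have a_mono j m : a j <= a (j + m)%N.
  by elim: m => [|m IH]; rewrite ?addn0// addnS (le_trans IH).
have b_mono j m : b (j + m)%N <= b j.
  by elim: m => [|m IH]; rewrite ?addn0// addnS (le_trans _ IH).
have ab k : a k <= b k by have := D0 k; rewrite /a /b twice; lra.
have abjk j k : a j <= b k.
  apply: le_trans (a_mono j k) _; apply: le_trans (ab _) _; rewrite addnC.
  exact: b_mono.
exists (sup (range a)) => k; rewrite ler_distl.
have -> : u k - 2 * D / 2 ^+ k = a k by [].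
have -> : u k + 2 * D / 2 ^+ k = b k by [].
apply/andP; split.
  by apply: ub_le_sup; [exists (b 0%N) => _ [j _ <-]|exists k].
by apply: ge_sup; [exists (a 0%N); exists 0%N|move=> _ [j _ <-]].
Qed.

(** F is the primitive of f vanishing at 0 on [-3, 3], extended by constants so that
    it is continuous and Lipschitz on the whole line. The interval on which the
    derivative is known is larger, to allow the mean value inequality up to the
    end points. *)
Definition primitive f (F : R -> 'rV[R]_n) : Prop := F 0 = 0 /\ exists2 F0 : R -> 'rV[R]_n,
  F = F0 \o clamp 3 & forall t : R, -4 < t < 4 -> is_derive t (1 : R) F0 (f t).

Lemma primitiveB f g F H : primitive f F -> primitive g H ->
  primitive (fun t => f t - g t) (fun t => F t - H t).
Proof.
move=> [F0 [F' FE dF]] [H0 [H' HE dH]]; split; first by rewrite F0 H0 subrr.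
exists (fun t => F' t - H' t) => [|t t4]; first by rewrite FE HE.
by have ? := dF t t4; have ? := dH t t4; exact: is_deriveB.
Qed.

Lemma scalar_primitive (f : R -> R) : continuous f ->
  exists F : R -> R, forall t : R, -4 < t < 4 -> is_derive t (1 : R) F (f t).
Proof.
move=> fc; pose F x := (\int[lebesgue_measure]_(t in `[-4, x]) f t)%R.
exists F => t /andP[t1 t2].
have [] := @continuous_FTC1_closed R f (-4) t 4 t2 _ t1 (fc t).
  apply: continuous_compact_integrable; first exact: segment_compact.
  exact: continuous_subspaceT.
by move=> dF FE; apply: DeriveDef => //; rewrite -derive1E.
Qed.

Lemma ex_primitive f : continuous f -> exists F, primitive f F.
Proof.
move=> fc.
have H i : exists F : R -> R, forall t : R, -4 < t < 4 -> is_derive t (1 : R) F (f t 0 i).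
  apply: scalar_primitive => t.
  by apply: (@continuous_comp _ _ _ f (fun v : 'rV[R]_n => v 0 i));
    [exact: fc|exact: coord_continuous].
have [F HF] := choice H.
pose F0 t : 'rV[R]_n := \row_i (F i t - F i 0).
exists (F0 \o clamp 3); split.
  rewrite /= clamp_id; last by lra.
  by apply/rowP => i; rewrite !mxE subrr.
exists F0 => // t t4.
have dF0 i j : is_derive t (1 : R) (fun t => F0 t i j) (f t 0 j).
  rewrite (_ : (fun t => _) = F j - cst (F j 0)); last first.
    by apply/funext => s; rewrite mxE.
  rewrite -[f t 0 j]subr0; have ? := HF j t t4; exact: is_deriveB.
have dF : derivable F0 t 1.
  by apply/derivable_mxP => i j; have [] := dF0 i j.
apply: DeriveDef => //; rewrite derive_mx//; apply/rowP => j; rewrite mxE.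
by have [_ ->] := dF0 0 j.
Qed.

(** The norm is the maximum of the coordinates, so the scalar mean value theorem
    can be applied to each of them separately. *)
Lemma MVT_rV f (F : R -> 'rV[R]_n) (s t K : R) : s <= t ->
  (forall r : R, s <= r <= t -> is_derive r (1 : R) F (f r)) ->
  (forall r : R, s <= r <= t -> `|f r| <= K) -> `|F t - F s| <= K * (t - s).
Proof.
move=> st dF fK.
have K0 : 0 <= K by apply: le_trans (fK s _) => //; rewrite lexx.
apply: ler_rV_norm => [|i]; first by rewrite mulr_ge0// subr_ge0.
have dFi r : s <= r <= t -> is_derive r (1 : R) (fun r => F r 0 i) (f r 0 i).
  move=> /dF[dFr <-]; apply: DeriveDef; first by move/derivable_mxP : dFr.
  by rewrite derive_mx ?mxE.
have [r||r rst] := @MVT_segment _ (fun r => F r 0 i) (fun r => f r 0 i) s t st.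
- by rewrite in_itv/= => /andP[/ltW sr /ltW rt]; apply: dFi; rewrite sr.
- apply: derivable_within_continuous => r; rewrite in_itv/= => rst.
  by have [] := dFi r rst.
- move: rst; rewrite in_itv/= => rst.
  rewrite !mxE => ->; rewrite normrM (ger0_norm (_ : 0 <= t - s)) ?subr_ge0//.
  rewrite ler_wpM2r ?subr_ge0//.
  exact: le_trans (rV_norm_coord _ _) (fK r _).
Qed.

Lemma primitive_lip f F K : primitive f F -> (forall t, `|f t| <= K) ->
  forall s t, `|F t - F s| <= K * `|t - s|.
Proof.
move=> [_ [F0 -> dF]] fK s t /=.
have K0 : 0 <= K by apply: le_trans (fK 0).
apply: le_trans (ler_wpM2l K0 (clamp_lip 3 s t)).
have := @clamp_itv 3 s (ler0n _ _); have := @clamp_itv 3 t (ler0n _ _).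
move: (clamp 3 s) (clamp 3 t) => {}s {}t t3 s3.
wlog st : s t t3 s3 / s <= t => [H|].
  by have [/H->//|/ltW/H] := leP s t; rewrite distrC (distrC s); exact.
rewrite (ger0_norm (_ : 0 <= t - s)) ?subr_ge0//.
by apply: (MVT_rV st) => [r rst|r _]; [apply: dF; lra|exact: fK].
Qed.

Lemma primitive_norm f F K : primitive f F -> (forall t, `|f t| <= K) ->
  forall t, `|F t| <= 3 * K.
Proof.
move=> fF fK t; have K0 : 0 <= K by apply: le_trans (fK 0).
have -> : F t = F (clamp 3 t) - F 0.
  have [-> [F0 -> _]] := fF; rewrite subr0 /= [clamp 3 (clamp 3 t)]clamp_id//.
  exact: clamp_itv.
apply: le_trans (primitive_lip fF fK _ _) _; rewrite mulrC ler_wpM2r// subr0.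
by rewrite ler_norml; exact: clamp_itv.
Qed.

(** Picard iteration y := y0 + primitive of f(t, y t). Primitives on [-3, 3] multiply
    sup norms by at most 3, so the Lipschitz constant 1/8 makes the iteration
    contract distances by 1/2. The iterates and their limit are Lipschitz with
    constant K, which provides the continuity of the limit. *)
Lemma picard (f : R -> 'rV[R]_n -> 'rV[R]_n) (y0 : 'rV[R]_n) (K : R) :
  (forall y : R -> 'rV[R]_n, continuous y -> continuous (fun t => f t (y t))) ->
  (forall t y z, `|f t y - f t z| <= 8^-1 * `|y - z|) ->
  (forall t y, `|f t y| <= K) ->
  exists y : R -> 'rV[R]_n, [/\ continuous y, y 0 = y0,
    forall t, `|y t - y0| <= 3 * K &
    forall t : R, -2 < t < 2 -> is_derive t (1 : R) y (f t (y t))].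
Proof.
move=> fc fL fK.
have /choice[A HA] : forall y : R -> 'rV[R]_n, exists F,
    continuous y -> primitive (fun t => f t (y t)) F.
  move=> y; have [yc|yc] := pselect (continuous y); last by exists y.
  by have [F HF] := ex_primitive (fc _ yc); exists F.
have K0 : 0 <= K by apply: le_trans (fK 0 0).
pose Phi y t := y0 + A y t.
pose Y k := iter k Phi (cst y0).
have PhiL y : continuous y -> forall s t, `|Phi y t - Phi y s| <= K * `|t - s|.
  move=> yc s t; rewrite /Phi opprD addrACA subrr add0r.
  by apply: primitive_lip (HA y yc) _ s t => r; exact: fK.
have Phic y : continuous y -> continuous (Phi y).
  by move=> yc; apply: lip_continuous (PhiL y yc).
have Yc k : continuous (Y k).
  by elim: k => [|k IH]; [exact: cst_continuous|exact: Phic].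
have PhiB y z D : continuous y -> continuous z -> (forall t, `|y t - z t| <= D) ->
    forall t, `|Phi y t - Phi z t| <= 2^-1 * D.
  move=> yc zc yzD t; rewrite /Phi opprD addrACA subrr add0r.
  have D0 : 0 <= D by apply: le_trans (yzD 0).
  have := primitive_norm (primitiveB (HA y yc) (HA z zc)) (K := 8^-1 * D).
  move=> H; apply: le_trans (H _ t) _; last by lra.
  by move=> r; apply: le_trans (fL r _ _) _; rewrite ler_wpM2l.
have YD k t : `|Y k.+1 t - Y k t| <= 3 * K / 2 ^+ k.
  elim: k t => [|k IH] t.
    rewrite expr0 divr1 /Y /= /Phi addrAC subrr add0r.
    by apply: primitive_norm (HA _ _) _ t => [|r]; [exact: cst_continuous|exact: fK].
  apply: le_trans (PhiB _ _ _ (Yc k.+1) (Yc k) IH t) _.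
  by rewrite exprS invfM mulrCA.
have /choice[y Hy] : forall t : R, exists v : 'rV[R]_n,
    forall k, `|v - Y k t| <= 2 * (3 * K) / 2 ^+ k.
  move=> t; have /choice[l Hl] : forall i, exists v : R,
      forall k, `|v - Y k t 0 i| <= 2 * (3 * K) / 2 ^+ k.
    move=> i; apply: fast_cauchy => k; apply: le_trans (YD k t).
    by have := rV_norm_coord (Y k.+1 t - Y k t) i; rewrite !mxE.
  exists (\row_i l i) => k; apply: ler_rV_norm => [|i]; last by rewrite !mxE.
  by rewrite divr_ge0 ?exprn_ge0// !mulr_ge0.
have yL s t : `|y t - y s| <= K * `|t - s|.
  apply: (@archi_le _ _ (2 * (2 * (3 * K)))) => k.
  have E : y t - y s = (Y k.+1 t - Y k.+1 s) + ((y t - Y k.+1 t) - (y s - Y k.+1 s)).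
    by rewrite opprB addrACA [Y _ t + _]addrC subrK addKr.
  rewrite {}E; apply: le_trans (ler_normD _ _) _; rewrite lerD//; first exact: PhiL.
  apply: le_trans (ler_normB _ _) _.
  have := Hy t k.+1; have := Hy s k.+1.
  rewrite exprS invfM; set q := (2 ^+ k)^-1.
  have : 0 <= K * q by rewrite mulr_ge0// invr_ge0 exprn_ge0.
  lra.
have yc : continuous y by exact: lip_continuous yL.
have yE : y = Phi y.
  apply/funext => t; apply/eqP; rewrite -subr_eq0 -normr_le0.
  apply: (@archi_le _ _ (2 * (2 * (3 * K)))) => k; rewrite add0r.
  rewrite -(subrKA (Y k.+1 t)); apply: le_trans (ler_normD _ _) _.
  have := Hy t k.+1.
  have := PhiB _ _ (2 * (3 * K) / 2 ^+ k) (Yc k) yc.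
  move=> /(_ _ t)H; have {}H := H (fun t => _).
  rewrite exprS invfM; set q := (2 ^+ k)^-1.
  have : 0 <= K * q by rewrite mulr_ge0// invr_ge0 exprn_ge0.
  have {H} : `|Y k.+1 t - Phi y t| <= 2^-1 * (2 * (3 * K) / 2 ^+ k).
    by apply: H => r; rewrite distrC.
  rewrite -/q; lra.
exists y; split=> //.
- by rewrite yE /Phi (HA y yc).1 addr0.
- move=> t; rewrite {1}yE /Phi addrC addKr.
  by apply: primitive_norm (HA y yc) _ t => r; exact: fK.
- move=> t t2; have [_ [F0 AE dF]] := HA y yc.
  have tD : is_derive t (1 : R) (cst y0 + F0) (f t (y t)).
    rewrite -[f t (y t)]add0r; have ? : is_derive t (1 : R) F0 (f t (y t)).
      by apply: dF; lra.
    exact: is_deriveD.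
  apply: near_eq_is_derive tD.
  have t2' : t \in `](-2), 2[ by rewrite in_itv.
  apply: filterS (near_in_itvoo t2') => s; rewrite in_itv/= => /andP[s1 s2].
  by rewrite [in RHS]yE /Phi AE /= clamp_id//; lra.
Qed.

End Picard.

Section LocalBounds.
Context {R : realType} {m n : nat}.

Lemma ball_cvx (x y z : 'rV[R]_m) (r s : R) : `|y - x| <= r -> `|z - x| <= r ->
  0 <= s <= 1 -> `|s *: (z - y) + y - x| <= r.
Proof.
move=> yr zr /andP[s0 s1].
have -> : s *: (z - y) + y - x = s *: (z - x) + (1 - s) *: (y - x).
  by apply/rowP => i; rewrite !mxE; ring.
apply: le_trans (ler_normD _ _) _; rewrite !normrZ (ger0_norm s0).
by rewrite ger0_norm ?subr_ge0//; nra.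
Qed.

Lemma near0_ball (x : 'rV[R]_m) (A : set 'rV[R]_m) : nbhs x A ->
  \forall r \near 0^'+, forall y, `|y - x| <= r -> A y.
Proof.
move=> /nbhs_ballP[e /= e0 eA]; near=> r => y yr; apply: eA.
rewrite -ball_normE /= distrC; apply: le_lt_trans yr _.
by near: r; exact: nbhs_right_lt.
Unshelve. all: by end_near. Qed.

(** The partial derivatives of h are bounded near x by continuity; integrate them
    along segments, which stay in the balls around x. The constant is the same
    for all small radii, which allows the radius to be shrunk later. *)
Lemma locally_lipschitz (U : set 'rV[R]_m) (h : 'rV[R]_m -> 'rV[R]_n) x :
  open U -> Cinfty U h -> U x ->
  exists K, \forall r \near 0^'+, forall y z, `|y - x| <= r -> `|z - x| <= r ->
    [/\ U y, `|h y| <= K & `|h z - h y| <= K * `|z - y|].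
Proof.
move=> Uo hU Ux.
have bnd (k : 'rV[R]_m -> 'rV[R]_n) : {for x, continuous k} ->
    \forall y \near x, `|k y| <= `|k x| + 1.
  move=> kx; have /cvgrPdist_le/(_ 1 ltr01) := kx; apply: filterS => y ky.
  rewrite -(subrK (k x) (k y)); apply: le_trans (ler_normD _ _) _.
  by rewrite addrC lerD2l distrC.
have Dc j : {for x, continuous ('D_(delta_mx 0 j) h)}.
  by have [_ Dh] := hU 1%N; exact: Dh Ux.
pose K := (`|h x| + 1) + \sum_(j < m) (`|'D_(delta_mx 0 j) h x| + 1).
have sum0 : 0 <= \sum_(j < m) (`|'D_(delta_mx 0 j) h x| + 1).
  by apply: sumr_ge0 => j _; rewrite addr_ge0.
exists K.
have : nbhs x (U `&` [set y | `|h y| <= `|h x| + 1] `&`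
  [set y | forall j, `|'D_(delta_mx 0 j) h y| <= `|'D_(delta_mx 0 j) h x| + 1]).
  apply: filterI; first apply: filterI.
  - exact: open_nbhs_nbhs.
  - by apply: bnd; exact: Cinfty_continuous hU Ux.
  - suff : \forall y \near x, forall j,
        `|'D_(delta_mx 0 j) h y| <= `|'D_(delta_mx 0 j) h x| + 1 by [].
    apply: (@filter_forall _ _ (fun (j : 'I_m) y =>
      `|'D_(delta_mx 0 j) h y| <= `|'D_(delta_mx 0 j) h x| + 1) (nbhs x)) => j.
    exact: bnd.
move=> /near0_ball; apply: filterS => r Hr y z yr zr.
have [[Uy hy] _] := Hr y yr; split=> //; first by rewrite (le_trans hy)// lerDl.
have dseg (s : R) : 0 <= s <= 1 ->
    is_derive s (1 : R) (fun s : R => h (s *: (z - y) + y)) ('D_(z - y) h (s *: (z - y) + y)).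
  move=> s01; have [[Us _] _] := Hr _ (ball_cvx yr zr s01).
  have da : is_diff s (fun s : R => s *: (z - y) + y) (fun s : R => s *: (z - y)).
    have -> : (fun s : R => s *: (z - y) + y) = ( *:%R ^~ (z - y)) + cst y by [].
    by apply: is_diff_eq; rewrite addr0.
  have := derive_affine (1 : R) da (Cinfty_differentiable hU Us).
  by rewrite scale1r.
have := MVT_rV (K := K * `|z - y|) ler01 dseg.
rewrite scale1r subrK scale0r add0r subr0 mulr1; apply => s s01.
have [[Us _] Ds] := Hr _ (ball_cvx yr zr s01).
have dh := Cinfty_differentiable hU Us.
rewrite deriveE// diff_rV_sum//.
apply: le_trans (ler_norm_sum _ _ _) _.
apply: (@le_trans _ _ (\sum_(j < m) `|z - y| * (`|'D_(delta_mx 0 j) h x| + 1))).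
  apply: ler_sum => j _; rewrite normrZ ler_pM//; exact: rV_norm_coord.
by rewrite -mulr_sumr mulrC ler_wpM2r// lerDr addr_ge0.
Qed.

Lemma locally_lipschitz_family (I : finType) (U : set 'rV[R]_m)
    (h : I -> 'rV[R]_m -> 'rV[R]_n) x :
  open U -> (forall i, Cinfty U (h i)) -> U x ->
  exists2 K, 0 <= K & \forall r \near 0^'+, forall y z, `|y - x| <= r -> `|z - x| <= r ->
    U y /\ forall i, `|h i y| <= K /\ `|h i z - h i y| <= K * `|z - y|.
Proof.
move=> Uo hU Ux.
have /choice[K HK] := fun i => locally_lipschitz Uo (hU i) Ux.
exists (\sum_i `|K i|); first by apply: sumr_ge0.
have Kle i : K i <= \sum_i `|K i|.
  by rewrite (bigD1 i)//=; apply: le_trans (ler_norm _) _; rewrite lerDl sumr_ge0.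
have := filter_forall (at_right_proper_filter (0 : R)) HK.
have := near0_ball (open_nbhs_nbhs (conj Uo Ux)).
move=> N1 N2.
apply: filterS2 N1 N2 => r HU Hh y z yr zr; split; first exact: HU.
move=> i; have [_ h1 h2] := Hh i y z yr zr; split; first exact: le_trans h1 _.
by apply: le_trans h2 _; rewrite ler_wpM2r.
Qed.

End LocalBounds.

Section ODE.
Context {R : realType} {n p : nat}.

Lemma Ck0T {V W : normedModType R} (f : V -> W) : Ck 0 setT f <-> continuous f.
Proof. by split=> [fc x|fc x _]; exact: fc. Qed.

(** If y is C^k then so is its derivative, by the equation. *)
Lemma ode_smooth (U : set R) (E : set 'rV[R]_n) (y a : R -> 'rV[R]_n)
    (B : 'I_n -> 'rV[R]_n -> 'rV[R]_n) :
  open U -> Cinfty U a -> (forall i, Cinfty E (B i)) ->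
  (forall t, U t -> E (y t)) ->
  (forall t, U t -> is_derive t (1 : R) y (\sum_i a t 0 i *: B i (y t))) ->
  Cinfty U y.
Proof.
move=> Uo aU BE UE dy.
have dfy t : U t -> differentiable y t.
  by move=> /dy[dyt _]; exact/derivable1_diffP.
elim=> [|k IH]; first by move=> t /dfy; exact: differentiable_continuous.
split=> [t /dfy//|v].
have H : Ck k U (fun t => \sum_i (v * a t 0 i) *: (B i \o y) t).
  apply: Ck_sum => // i; apply: Ck_scale => //.
    apply: Ck_mul => //; first exact: Ck_cst.
    exact: ((Ck_rVP _ _ Uo).1 (aU k)).
  exact: Ck_comp (BE i k).
apply: (Ck_ext Uo) H => t /set_mem Ut.
rewrite deriveE ?(diff1E (dfy t Ut)); last exact: dfy.
rewrite derive1E; have [_ ->] := dy t Ut.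
by rewrite scaler_sumr; apply: eq_bigr => i _; rewrite scalerA.
Qed.

(** The retraction onto the ball of radius r around x, which is a cube for the
    norm at hand. *)
Definition clamp_rV (x : 'rV[R]_n) (r : R) (y : 'rV[R]_n) : 'rV[R]_n :=
  x + \row_i clamp r ((y - x) 0 i).

Lemma clamp_rV_ball x r y : 0 <= r -> `|clamp_rV x r y - x| <= r.
Proof.
move=> r0; rewrite /clamp_rV addrC addKr; apply: ler_rV_norm => // i.
by rewrite mxE ler_norml clamp_itv.
Qed.

Lemma clamp_rV_lip x r y z : `|clamp_rV x r y - clamp_rV x r z| <= 1 * `|y - z|.
Proof.
rewrite /clamp_rV opprD addrACA subrr add0r mul1r; apply: ler_rV_norm => // i.
rewrite !mxE; apply: le_trans (clamp_lip _ _ _) _.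
apply: le_trans (rV_norm_coord (y - z) i); rewrite !mxE.
rewrite [leLHS](_ : _ = `|y 0 i - z 0 i|)//; congr Num.norm; ring.
Qed.

Lemma clamp_rV_id x r y : `|y - x| <= r -> clamp_rV x r y = y.
Proof.
move=> yr; rewrite /clamp_rV [X in _ + X](_ : _ = y - x); first by rewrite addrC subrK.
apply/rowP => i; rewrite mxE clamp_id// -ler_norml.
exact: le_trans (rV_norm_coord _ _) yr.
Qed.

(** The right-hand side is linear in v: replacing v by a small multiple makes both
    its size and its Lipschitz constant as small as needed, and the solution
    exists on a fixed time interval. The coefficients are extended to the whole
    space by clamping the time and the unknown; the a priori bound on y shows
    that the clamping of the unknown is never felt. *)
Lemma ode_local (E : set 'rV[R]_n) (Z : set 'rV[R]_p)
    (B : 'I_n -> 'rV[R]_n -> 'rV[R]_n) (A : 'I_p -> 'rV[R]_p -> 'rV[R]_n) e z :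
  open E -> open Z -> E e -> Z z ->
  (forall i, Cinfty E (B i)) -> (forall j, Cinfty Z (A j)) ->
  \forall v \near (0 : 'rV[R]_p), exists y : R -> 'rV[R]_n, y 0 = e /\
    forall t : R, -2 < t < 2 -> [/\ Z (t *: v + z), E (y t) &
      is_derive t (1 : R) y
        (\sum_i (\sum_j v 0 j *: A j (t *: v + z)) 0 i *: B i (y t))].
Proof.
move=> Eo Zo Ee Zz BE AZ.
have [KB KB0 HB] := locally_lipschitz_family Eo BE Ee.
have [KA KA0 HA] := locally_lipschitz_family Zo AZ Zz.
have [r [r0 [{}HA {}HB]]] := filter_ex (filterI (nbhs_right_gt (0 : R)) (filterI HA HB)).
pose N := n%:R * (p%:R * KA) * KB.
have N0 : 0 <= N by rewrite !mulr_ge0.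
(* The three bounds keep the segment in the ball of radius r for times in
   [-2, 2], make the equation 1/8-Lipschitz, and keep the solution in the ball. *)
pose dl := Num.min (r / 2) (Num.min (8^-1 / (N + 1)) (r / (3 * (N + 1)))).
have dl0 : 0 < dl by rewrite !lt_min !divr_gt0// ?mulr_gt0// ltr_pwDr.
near=> v.
have vdl : `|v| <= dl.
  by near: v; apply: cvgr0_norm_le => //; exact: cvg_id.
have v1 : `|v| <= r / 2 by apply: le_trans vdl _; rewrite ge_min lexx.
have v2 : N * `|v| <= 8^-1.
  apply: (@le_trans _ _ ((N + 1) * `|v|)); first by rewrite ler_wpM2r// lerDl.
  rewrite mulrC -ler_pdivlMr ?ltr_pwDr//.
  by apply: le_trans vdl _; rewrite !ge_min lexx orbT.
have v3 : 3 * (N * `|v|) <= r.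
  apply: (@le_trans _ _ (3 * (N + 1) * `|v|)).
    by rewrite mulrA ler_wpM2r// ler_wpM2l// lerDl.
  rewrite mulrC -ler_pdivlMr ?mulr_gt0 ?ltr_pwDr//.
  by apply: le_trans vdl _; rewrite !ge_min lexx !orbT.
pose zt t := clamp 2 t *: v + z.
have ztr t : `|zt t - z| <= r.
  rewrite /zt addrK normrZ; have : `|clamp 2 t| <= 2 by rewrite ler_norml clamp_itv.
  move=> c2; apply: le_trans (ler_wpM2r (normr_ge0 v) c2) _.
  by lra.
pose a t := \sum_j v 0 j *: A j (zt t).
have aK t : `|a t| <= p%:R * KA * `|v|.
  apply: le_trans (ler_norm_sum _ _ _) _.
  apply: (@le_trans _ _ (\sum_(j < p) (KA * `|v|))).
    apply: ler_sum => j _; rewrite normrZ mulrC.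
    by apply: ler_pM => //; [have [_ /(_ j)[]] := HA _ _ (ztr t) (ztr t)|exact: rV_norm_coord].
  by rewrite sumr_const card_ord -mulrA mulr_natl.
pose pr := clamp_rV e r.
have prr y : `|pr y - e| <= r by apply: clamp_rV_ball; exact: ltW.
pose f t y := \sum_i a t 0 i *: B i (pr y).
have fK t y : `|f t y| <= N * `|v|.
  apply: le_trans (ler_norm_sum _ _ _) _.
  apply: (@le_trans _ _ (\sum_(j < n) (p%:R * KA * `|v| * KB))).
    apply: ler_sum => i _; rewrite normrZ.
    apply: ler_pM => //; first exact: le_trans (rV_norm_coord _ _) (aK t).
    by have [_ /(_ i)[]] := HB _ _ (prr y) (prr y).
  by rewrite sumr_const card_ord -[leLHS]mulr_natl /N; lra.
have fL t y w : `|f t y - f t w| <= 8^-1 * `|y - w|.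
  rewrite /f -sumrB; under eq_bigr do rewrite -scalerBr.
  apply: le_trans (ler_norm_sum _ _ _) _.
  apply: (@le_trans _ _ (\sum_(j < n) (p%:R * KA * `|v| * (KB * `|y - w|)))).
    apply: ler_sum => i _; rewrite normrZ.
    apply: ler_pM => //; first exact: le_trans (rV_norm_coord _ _) (aK t).
    have [_ /(_ i)[_ h]] := HB _ _ (prr w) (prr y); apply: le_trans h _.
    by rewrite ler_wpM2l//; have := clamp_rV_lip e r y w; rewrite mul1r.
  rewrite sumr_const card_ord -[leLHS]mulr_natl.
  apply: le_trans (ler_wpM2r (normr_ge0 (y - w)) v2).
  by rewrite /N; lra.
have ztc : continuous zt.
  move=> t; apply: cvgD; last exact: cvg_cst.
  by apply: cvgZr_tmp; exact: clamp_continuous.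
have ac : continuous a.
  apply/Ck0T; apply: Ck_sum; first exact: openT.
  move=> j; apply: Ck_scale; [exact: openT|exact: Ck_cst|].
  apply/Ck0T => t; apply: (@continuous_comp _ _ _ zt (A j)); first exact: ztc.
  by apply: Cinfty_continuous (AZ j) _; have [] := HA _ _ (ztr t) (ztr t).
have prc : continuous pr.
  by apply: (@lip_continuous _ _ _ pr 1) => s t; exact: clamp_rV_lip.
have fc (y : R -> 'rV[R]_n) : continuous y -> continuous (fun t => f t (y t)).
  move=> yc; apply/Ck0T; apply: Ck_sum; first exact: openT.
  move=> i; apply: Ck_scale; first exact: openT.
    exact/(Ck_rVP _ _ openT).1/Ck0T.
  apply/Ck0T => t; apply: (@continuous_comp _ _ _ (pr \o y) (B i)).
    by apply: continuous_comp; [exact: yc|exact: prc].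
  by apply: Cinfty_continuous (BE i) _; have [] := HB _ _ (prr (y t)) (prr (y t)).
have [y [yc ye yr dy]] := picard e fc fL fK.
exists y; split=> // t t2.
have ztE : t *: v + z = zt t by rewrite /zt clamp_id//; lra.
have yre : `|y t - e| <= r by exact: le_trans (yr t) v3.
split.
- by rewrite ztE; have [] := HA _ _ (ztr t) (ztr t).
- by have [] := HB _ _ yre yre.
- have := dy t t2; rewrite /f /a -ztE.
  by have -> : pr (y t) = y t by exact: clamp_rV_id.
Unshelve. all: by end_near. Qed.

End ODE.

(** * Developing curves in a chart of the group *)

Section LieFrame.
Context {R : realType} {n : nat} (G : lieGroupType R n).

Let e := chart_at (1%g : G).
Let E := e @` chart_dom e.

Let mulG (x : (G * G)%type) : G := (x.1 * x.2)%g.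
Let m : 'rV[R]_(n + n) -> 'rV[R]_n :=
  e \o mulG \o chart_inv (chart_at ((1%g, 1%g) : (G * G)%type)).

(** In the chart at 1, the left invariant vector field extending the i-th basis
    vector: the derivative of the product y * x in x at the identity. *)
Definition lie_frame (i : 'I_n) (y : 'rV[R]_n) : 'rV[R]_n :=
  'D_(row_mx 0 (delta_mx 0 i)) m (row_mx y (e 1%g)).

Let e_dom : chart_dom e 1%g. Proof. exact: chart_at_dom. Qed.

Let S := chart_at ((1%g, 1%g) : (G * G)%type) @`
  (chart_dom (chart_at ((1%g, 1%g) : (G * G)%type)) `&` setT `&`
   mulG @^-1` chart_dom e).

Let S_row y : E y -> S (row_mx y (e 1%g)).
Proof.
move=> [g ge <-]; exists (g, 1%g) => //; split; first by split.
by rewrite /mulG /= mulg1.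
Qed.

Let mS : Cinfty S m.
Proof. exact: (@lie_mul_smooth R n G).2 (1%g, 1%g) 1%g. Qed.

(** The field is a partial derivative of the group law, restricted to a slice. *)
Lemma lie_frame_smooth i : Cinfty E (lie_frame i).
Proof.
have Dm : Cinfty S ('D_(row_mx 0 (delta_mx 0 i)) m).
  by move=> k; have [_] := mS k.+1; exact.
apply: (@Cinfty_comp _ _ _ _ E S (fun y => row_mx y (e 1%g)) _ _ S_row _ Dm).
  exact: chart_img_open.
by apply: Cinfty_affine => y; exact: is_diff_row_mxl.
Qed.

(** With g the point of the curve at time t, the coordinates of left
    translation by g and by its inverse are mutually inverse near the identity.
    The differential of the first maps a to the velocity of y, so that of the
    second, which computes the Maurer-Cartan form, maps it back to a. *)
Lemma maurer_cartan_lie_frame (U : set R) (y : R -> 'rV[R]_n) (a : 'rV[R]_n) t :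
  open U -> Cinfty U y -> (forall t, U t -> E (y t)) -> U t ->
  is_derive t (1 : R) y (\sum_i a 0 i *: lie_frame i (y t)) ->
  maurer_cartan (velocity (chart_inv e \o y) t) = a.
Proof.
move=> Uo yU yE Ut [_ dy].
have cU : smooth_from U (chart_inv e \o y) by exact: smooth_from_comp_chart_inv.
have [g ge gy] := yE t Ut.
have eg : chart_inv e (y t) = g by rewrite -gy chart_mapK ?mem_set.
rewrite (maurer_cartan_velocity Uo cU Ut) /= eg.
pose phi := e \o (fun x => g * x)%g \o chart_inv e.
pose psi := e \o (fun x => g^-1 * x)%g \o chart_inv e.
have dphi : differentiable phi (e 1%g).
  apply: (smooth_open_differentiable (smooth_lmul g) I e_dom _).
  by rewrite mulg1.
have dpsi : differentiable psi (y t).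
  rewrite -gy; apply: (smooth_open_differentiable (smooth_lmul (g^-1)%g) I ge _).
  by rewrite mulVg.
have phi1 : phi (e 1%g) = y t.
  by rewrite /phi /= chart_mapK ?mem_set// mulg1.
have -> : (e \o (fun s => g^-1 * chart_inv e (y s))%g) = psi \o y by [].
have dyt : differentiable y t by exact: Cinfty_differentiable yU Ut.
rewrite derive1E deriveE; last exact: differentiable_comp.
rewrite (diff_comp dyt dpsi) /= -(deriveE _ dyt) dy.
have -> : \sum_i a 0 i *: lie_frame i (y t) = 'd phi (e 1%g) a.
  rewrite (diff_rV_sum a dphi); apply: eq_bigr => i _; congr (_ *: _).
  have dm : differentiable m (row_mx (y t) (e 1%g)).
    by apply: Cinfty_differentiable mS _; exact/S_row/yE.
  have [_ /= dmE] := derive_affine (delta_mx 0 i) (is_diff_row_mxr (y t) (e 1%g)) dm.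
  have phiE : phi = m \o (fun z => row_mx (y t) z).
    by apply/funext => z; rewrite /m /phi /mulG /= row_mxKl row_mxKr eg.
  by rewrite /lie_frame -dmE phiE.
have dpsi' : differentiable psi (phi (e 1%g)) by rewrite phi1.
have dd := diff_comp dphi dpsi'; rewrite phi1 in dd.
transitivity ('d (psi \o phi) (e 1%g) a); first exact: (esym (congr1 (fun f => f a) dd)).
have idE : \forall z \near e 1%g, id z = (psi \o phi) z.
  have lc : {for e 1%g, continuous (fun z => g * chart_inv e z)%g}.
    apply: (@continuous_comp _ _ _ (chart_inv e) (fun x => g * x)%g).
      exact: chart_inv_continuous.
    exact: (smooth_lmul g).1.
  have N1 : nbhs (e 1%g) E.
    apply: open_nbhs_nbhs; split; first exact: chart_img_open.
    by exists 1%g.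
  have N2 : nbhs (e 1%g) ((fun z => g * chart_inv e z)%g @^-1` chart_dom e).
    apply: lc; rewrite chart_mapK ?mem_set// mulg1.
    by apply: open_nbhs_nbhs; split; first exact: chart_dom_open.
  apply: filterS2 N1 N2 => _ [w we <-] /=; rewrite chart_mapK ?mem_set// => gwe.
  by rewrite /phi /psi /= !chart_mapK ?mem_set// mulKg.
rewrite -deriveE; last exact: differentiable_comp.
by rewrite -(near_eq_derive _ idE) derive_id.
Qed.

End LieFrame.

(** * Any two points are joined by a development *)

Section Connectedness.
Context {R : realType} {n p d : nat} {G : lieGroupType R n}
  {H : modelGeometry G} {P : manifoldType R p} {M : manifoldType R d}.
Variable C : cartanGeometry H P M.

Definition omega_coord (u : P) (j : 'I_p) (z : 'rV[R]_p) : 'rV[R]_n :=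
  omega C (chart_inv (chart_at u) z) (coord_field u (delta_mx 0 j) z).

Lemma linear_comp_delta q (V W : lmodType R) (L : {linear 'rV[R]_q -> V})
  (O : {linear V -> W}) v : O (L v) = \sum_j v 0 j *: O (L (delta_mx 0 j)).
Proof.
rewrite {1}(row_sum_delta v) !linear_sum; apply: eq_bigr => j _.
by rewrite !linearZ.
Qed.

Lemma omega_line (u : P) (v z : 'rV[R]_p) (t : R) :
  (chart_at u @` chart_dom (chart_at u)) (t *: v + z) ->
  let c := chart_inv (chart_at u) \o (fun t : R => t *: v + z) in
  omega C (c t) (velocity c t) = \sum_j v 0 j *: omega_coord u j (t *: v + z).
Proof.
move=> Zt c; pose psi := chart_at (c t) \o chart_inv (chart_at u).
have dpsi : differentiable psi (t *: v + z).
  apply: smooth_from_differentiable (smooth_from_chart_inv u) Zt _; exact: chart_at_dom.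
have -> : velocity c t = coord_field u v (t *: v + z).
  rewrite /velocity derive1E.
  have [_ /= E] := derive_affine (1 : R) (is_diff_line v z t) dpsi.
  transitivity ('D_(1 *: v) psi (t *: v + z)); first exact: E.
  by rewrite scale1r (deriveE _ dpsi).
exact: (@linear_comp_delta _ (tangent (c t)) (lie_algebra G)
  ('d psi (t *: v + z)) (omega C (c t)) v).
Qed.

(** Join u to u' by a segment in the chart at u, of direction v. Its development in
    the chart of G at 1 is the solution of the equation of [ode_local] for the
    frame [lie_frame] and the coefficients [omega_coord]. *)
Lemma local_development (u : P) :
  \forall u' \near u, exists g, is_development_of C u u' g.
Proof.
pose z0 := chart_at u u.
pose Z := chart_at u @` chart_dom (chart_at u).
pose e := chart_at (1%g : G).
have Zo : open Z by exact: chart_img_open.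
have Zz0 : Z z0 by exists u => //; exact: chart_at_dom.
have Eo : open (e @` chart_dom e) by exact: chart_img_open.
have Ee : (e @` chart_dom e) (e 1%g) by exists 1%g => //; exact: chart_at_dom.
have AZ j : Cinfty Z (omega_coord u j) by exact: omega_smooth.
have N1 := ode_local Eo Zo Ee Zz0 (@lie_frame_smooth R n G) AZ.
have N2 : \forall u' \near u, chart_dom (chart_at u) u'.
  by apply: open_nbhs_nbhs; split; [exact: chart_dom_open|exact: chart_at_dom].
have vc Q : nbhs (0 : 'rV[R]_p) Q -> nbhs u (fun w => Q (chart_at u w - z0)).
  move: Q; suff : chart_at u w - z0 @[w --> u] --> (0 : 'rV[R]_p) by [].
  rewrite -(subrr z0); apply: cvgB; last exact: cvg_cst.
  by apply: chart_map_continuous; exact: chart_at_dom.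
apply: filterS2 (vc _ N1) N2 => u' [y [y0 Hy]] u'u.
set v := chart_at u u' - z0 in y0 Hy.
pose c := chart_inv (chart_at u) \o (fun t : R => t *: v + z0).
pose cG := chart_inv e \o y.
pose U := [set t : R | -2 < t < 2].
have UE : U = `]-2, 2[%classic by apply/seteqP; split=> t /=; rewrite in_itv.
have Uo : open U by rewrite UE; exact: itv_open.
pose a t := \sum_j v 0 j *: omega_coord u j (t *: v + z0).
have lineU : Cinfty U (fun t : R => t *: v + z0).
  exact (@Cinfty_affine _ _ _ U _ (fun t : R => t *: v) (is_diff_line v z0)).
have aU : Cinfty U a.
  move=> k; apply: Ck_sum => // j; apply: Ck_scale => //; first exact: Ck_cst.
  apply: Ck_comp (lineU k) (AZ j k) => // t Ut.
  by have [] := Hy t Ut.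
have yU : Cinfty U y.
  apply: (ode_smooth Uo aU (@lie_frame_smooth R n G)) => t Ut.
    by have [] := Hy t Ut.
  by have [] := Hy t Ut.
have cU : smooth_from U c.
  by apply: smooth_from_comp_chart_inv => // t Ut; have [] := Hy t Ut.
have cGU : smooth_from U cG.
  by apply: smooth_from_comp_chart_inv => // t Ut; have [] := Hy t Ut.
have arc m (T : manifoldType R m) (f : R -> T) : smooth_from U f -> pw_smooth f 0 1.
  move=> fU; apply: pw_arc => //; exists U, f; split=> //.
  by move=> t /=; rewrite in_itv /U /=; lra.
have U1 t : 0 < t < 1 -> U t by rewrite /U /=; lra.
have cD : develops_on C 0 1 c cG.
  split; [exact: arc|exact: arc|exists [::] => t /U1 Ut _].
  split; [by exists U|by exists U|].
  have [Zt Et dy] := Hy t Ut.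
  rewrite omega_line//; apply/esym.
  apply: maurer_cartan_lie_frame Uo yU _ Ut dy => s Us.
  by have [] := Hy s Us.
have H1 : H 1%g by have [] := closed_subgroupP H.
exists ((cG 0%R)^-1 * cG 1%R * 1)%g; apply/is_development_ofP.
exists 0, 1, c, cG, 1%g; split=> //.
- by rewrite /c /= scale0r add0r chart_mapK// mem_set//; exact: chart_at_dom.
- by rewrite act1 /c /= scale1r subrK chart_mapK// mem_set.
Qed.

Lemma proj_surj (x : M) : exists u, Defs.proj C u = x.
Proof.
have [U [Phi [Psi [Uo Ux [_ _ surj] K [_ _ Phi1 _]]]]] := local_triviality C x.
have [|u Uu E] := surj (x, 1%g).
  by split=> //=; have [] := closed_subgroupP H.
by exists u; rewrite -Phi1// E.
Qed.

Lemma fiber_act (u u' : P) : Defs.proj C u = Defs.proj C u' -> exists2 h, H h & act C u h = u'.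
Proof.
move=> uu'.
have [U [Phi [Psi [Uo Ux [fn inj _] _ [_ _ Phi1 Phia]]]]] := local_triviality C (Defs.proj C u).
have Uu' : U (Defs.proj C u') by rewrite -uu'.
have [_ Hu] := fn u Ux; have [_ Hu'] := fn u' Uu'.
have [_ HM HV] := closed_subgroupP H.
exists ((Phi u).2^-1 * (Phi u').2)%g; first exact: HM (HV _ Hu) Hu'.
have Hh : H ((Phi u).2^-1 * (Phi u').2)%g by exact: HM (HV _ Hu) Hu'.
apply: inj; rewrite ?inE/= ?proj_act//.
rewrite Phia// mulVKg Phi1// uu' -Phi1//; exact/esym/surjective_pairing.
Qed.

(** Near proj u, a local trivialization gives a continuous section of the
    projection through u. *)
Lemma proj_nbhs (u : P) (N : set P) : nbhs u N -> nbhs (Defs.proj C u) (Defs.proj C @` N).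
Proof.
move=> uN.
have [U [Phi [Psi [Uo Ux [fn inj surj] PK [_ Psis Phi1 Phia]]]]] :=
  local_triviality C (Defs.proj C u).
have [_ Hu] := fn u Ux.
have [W [F [Wo Wu Fs FE]]] := Psis (Defs.proj C u, (Phi u).2) (conj Ux Hu).
have Fu : F (Defs.proj C u, (Phi u).2) = u.
  rewrite FE; last by apply/mem_set.
  by rewrite -Phi1// -surjective_pairing PK// mem_set.
have Fc : {for Defs.proj C u, continuous (fun x => F (x, (Phi u).2))}.
  apply: (@continuous_comp _ _ _ (fun x => (x, (Phi u).2)) F).
    by apply: cvg_pair; [exact: cvg_id|exact: cvg_cst].
  exact: Fs.1.
have N1 : nbhs (Defs.proj C u) ((fun x => F (x, (Phi u).2)) @^-1` N).
  by apply: Fc; rewrite Fu.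
have N2 : nbhs (Defs.proj C u) ((fun x => (x, (Phi u).2)) @^-1` W).
  have ic : {for Defs.proj C u, continuous (fun x : M => (x, (Phi u).2))}.
    by apply: cvg_pair; [exact: cvg_id|exact: cvg_cst].
  by apply: ic; exact: open_nbhs_nbhs.
have N3 : nbhs (Defs.proj C u) U by exact: open_nbhs_nbhs.
apply: filterS2 (filterI N1 N2) N3 => x [Nx Wx] Ux'.
exists (F (x, (Phi u).2)) => //.
rewrite FE; last by apply/mem_set; split=> //.
have [w Uw wE] := surj (x, (Phi u).2) (conj Ux' Hu).
by rewrite -wE PK ?mem_set// -Phi1// wE.
Qed.

(** The points with a development from o form an open set of P, whose complement
    is open as well because developments compose; both are unions of fibers, so
    their projections are open and complementary in M. *)
Lemma development_exists (o u : P) : connected [set: M] ->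
  exists g, is_development_of C o u g.
Proof.
move=> connM; pose A := [set w : P | exists g, is_development_of C o w g].
have A_act w w' : Defs.proj C w = Defs.proj C w' -> A w -> A w'.
  move=> /fiber_act[h Hh <-] [g og]; exists (g * h)%g.
  exact: development_trans og (development_fiber _ _ Hh).
have Aproj w : (Defs.proj C @` A) (Defs.proj C w) -> A w.
  by move=> [w' Aw' E]; exact: A_act E Aw'.
have Ao : open A.
  rewrite openE => w [g og]; apply: filterS (local_development w) => w' [k wk].
  by exists (g * k)%g; exact: development_trans og wk.
have Ac : open (~` A).
  rewrite openE => w Aw; apply: filterS (local_development w) => w' [k wk] [g og].
  by apply: Aw; exists (g * k^-1)%g; exact: development_trans og (development_inv wk).
have open_proj (B : set P) : open B -> open (Defs.proj C @` B).
  move=> Bo; rewrite openE => _ [w Bw <-]; apply: proj_nbhs.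
  exact: open_nbhs_nbhs.
have projC : Defs.proj C @` (~` A) = ~` (Defs.proj C @` A).
  apply/seteqP; split=> [_ [w Aw <-] /Aproj//|x Ax].
  have [w wx] := proj_surj x; exists w => // Aw.
  by apply: Ax; exists w.
have H1 : H 1%g by have [] := closed_subgroupP H.
have oo : A o by exists 1%g; rewrite -[X in is_development_of _ _ X](act1 C); exact: development_fiber.
have projA : Defs.proj C @` A = setT.
  apply: connM.
  - by exists (Defs.proj C o), o.
  - by exists (Defs.proj C @` A); [exact: open_proj|rewrite setTI].
  - exists (Defs.proj C @` A); last by rewrite setTI.
    by rewrite -openC -projC; exact: open_proj.
by apply: Aproj; rewrite projA.
Qed.

End Connectedness.

(** * Automorphisms and curved cosets *)

Theorem theorem6p4 (R : realType) (n p d : nat) (G : lieGroupType R n)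
    (H : modelGeometry G) (P : manifoldType R p) (M : manifoldType R d)
    (C : cartanGeometry H P M) (connM : connected [set: M])
    (o : P) (J : set G) (Jgrp : subgroup J) (HolJ : holonomy C o `<=` J)
    (phi : P -> P) (aut_phi : automorphism C phi) (u : P) :
  phi @` curved_right_coset C o J u = curved_right_coset C o J u <->
  curved_left_coset C o J (phi o).
Proof.
have [J1 JM JV] := Jgrp.
have D_ex := development_exists C _ _ connM.
have cosetP u' : curved_right_coset C o J u u' <-> exists g x,
    [/\ is_development_of C o u g, J x & is_development_of C o u' (x * g)%g].
  split.
    move=> [g og [_ [x Jx <-] ux]]; exists g, x; split=> //.
    by have := development_trans og ux; rewrite conjgE !mulgA mulgV mul1g.
  move=> [g [x [og Jx ox]]]; exists g => //; exists (x ^ g)%g; first by exists x.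
  by have := development_trans (development_inv og) ox; rewrite conjgE.
split=> [phiJ|[x Jx ox]].
  have [g og] := D_ex o u.
  have : curved_right_coset C o J u (phi u).
    rewrite -phiJ; exists u => //; apply/cosetP; exists g, 1%g.
    by split=> //; rewrite mul1g.
  move=> /cosetP[k [x [ok Jx oxk]]]; exists x => //.
  have := development_trans oxk (development_inv (development_aut aut_phi ok)).
  by rewrite mulgK.
have phiD w k : is_development_of C o w k -> is_development_of C o (phi w) (x * k)%g.
  by move=> /(development_aut aut_phi); exact: development_trans.
apply/seteqP; split=> [_ [w /cosetP[g [y [og Jy oyg]]] <-]|w /cosetP[g [y [og Jy oyg]]]].
  apply/cosetP; exists g, (x * y)%g; split=> //; first exact: JM.
  by rewrite -mulgA; exact: phiD.
have [[phi' phi'K phiK'] _ _ _] := aut_phi.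
exists (phi' w) => //; apply/cosetP.
have [k ok] := D_ex o (phi' w).
have := phiD _ _ ok; rewrite phiK' => owxk.
(* Both x k and y g are developments of w from o. *)
have Jh : J (x * k * (y * g)^-1)%g.
  by apply: HolJ; exact: development_trans owxk (development_inv oyg).
exists g, (k * g^-1)%g; split=> //; last by rewrite mulgVK.
have := JM _ _ (JM _ _ (JV _ Jx) Jh) Jy.
by rewrite invgM !mulgA mulVg mul1g mulgVK.
Qed.
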